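(* Let $m>1$ be real and let $(M^n,g,w)$ be a $(\lambda,n+m)$-Einstein manifold. Then for all tangent vectors $X,Y,Z$ $$\frac wm\bigl((\nabla_XP)(Y,Z)-(\nabla_YP)(X,Z)\bigr)=-Q(X,Y,Z,\nabla w)-\frac1m(g\odot g)\bigl(X,Y,Z,P(\nabla w)\bigr).$$
   Context: A $(\lambda,n+m)$-Einstein manifold $(M^n,g,w)$ (for $m>1$) is a connected complete Riemannian $n$-manifold $(M,g)$, possibly with boundary, together with a smooth function $w$ on $M$ such that $\mathrm{Hess}\,w=\frac{w}{m}(\mathrm{Ric}-\lambda g)$ on $M$, $w>0$ on $\mathrm{int}(M)$, and $w=0$ on $\partial M$. Define the function $\rho=\frac{1}{m-1}\bigl((n-1)\lambda-\mathrm{scal}\bigr)$, the symmetric $(0,2)$-tensor $P=\mathrm{Ric}-\rho g$, and the $(0,4)$-tensor $$Q=R+\frac2m\mathrm{Ric}\odot g-\frac{\lambda+\rho}{m}g\odot g.$$ $P(\nabla w)$ denotes the vector field with $g(P(\nabla w),X)=P(\nabla w,X)$. For symmetric $(0,2)$-tensors $s,r$, $$(s\odot r)(X,Y,Z,W)=\tfrac12\bigl(r(X,W)s(Y,Z)+r(Y,Z)s(X,W)-r(X,Z)s(Y,W)-r(Y,W)s(X,Z)\bigr).$$ The curvature tensor convention is $R(X,Y,Z,W)=g(\nabla_X\nabla_YZ-\nabla_Y\nabla_XZ-\nabla_{[X,Y]}Z,W)$, so $\mathrm{Ric}(X,Y)=\sum_iR(X,E_i,E_i,Y)$ for an orthonormal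 basis $E_i$. *)

(* Defs.v *)
From mathcomp Require Import all_boot all_order all_algebra.
From mathcomp Require Import all_classical all_reals all_analysis.

Set Implicit Arguments.
Unset Strict Implicit.
Unset Printing Implicit Defensive.

Import Order.TTheory GRing.Theory Num.Theory numFieldNormedType.Exports.

Local Open Scope classical_set_scope.
Local Open Scope ring_scope.

(** Tangent and cotangent vectors in a chart are row vectors of components;
    a (0,2)-tensor at a point is the matrix of its components. *)

Section Calculus.
Variables (R : realType) (n : nat).

(* The model space of n-manifolds with boundary; a point if n = 0. *)
Definition half_space : set 'rV[R]_n :=
  [set x | forall k : 'I_n, val k = 0%N -> 0 <= x 0 k].

Definition basis_vec (k : 'I_n) : 'rV[R]_n := delta_mx 0 k.

(* Derivative of f at x in direction v along the h such that x + h v stays in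
   A: one-sided when x is a boundary point of A and v is transverse to the
   boundary, two-sided otherwise. *)
Definition dquot (V : normedModType R) (f : V -> R) (x v : V) (h : R) : R :=
  h^-1 * (f (x + h *: v) - f x).

Definition within_dir (V : normedModType R) (A : set V) (x v : V) :
    set_system R :=
  within [set h : R | A (x + h *: v)] 0^'.

Definition derivable_within (V : normedModType R) (A : set V) (f : V -> R)
    (x v : V) : Prop :=
  cvg (dquot f x v @ within_dir A x v).

Definition derive_within (V : normedModType R) (A : set V) (f : V -> R)
    (x v : V) : R :=
  lim (dquot f x v @ within_dir A x v).

Definition pd (k : 'I_n) (f : 'rV[R]_n -> R) (x : 'rV[R]_n) : R :=
  derive_within half_space f x (basis_vec k).

(* The differential of f at x applied to v. *)
Definition dvec (f : 'rV[R]_n -> R) (x v : 'rV[R]_n) : R :=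
  \sum_k v 0 k * pd k f x.

(* C^r on an open set V. *)
Fixpoint Cr (r : nat) (V : set 'rV[R]_n) (f : 'rV[R]_n -> R) : Prop :=
  (forall x, V x -> {for x, continuous f}) /\
  match r with
  | 0%N => True
  | r'.+1 => forall k : 'I_n,
      (forall x, V x -> derivable f x (basis_vec k)) /\
      Cr r' V (fun x => 'D_(basis_vec k) f x)
  end.

(* C^oo on an arbitrary subset A: local existence of C^oo extensions. *)
Definition smooth_on (A : set 'rV[R]_n) (f : 'rV[R]_n -> R) : Prop :=
  forall x, A x -> exists V : set 'rV[R]_n, exists F : 'rV[R]_n -> R,
    [/\ open V, V x, (forall r, Cr r V F) &
        forall y, V y -> A y -> F y = f y].

End Calculus.

Section Tensors.
Variables (R : realType) (n : nat).
Implicit Types (B S T : 'M[R]_n) (X Y Z W : 'rV[R]_n).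

Definition ev2 B X Y : R := (X *m B *m Y^T) 0 0.

(* Metric contraction g^{ab} B_{ab}; see gtraceE. *)
Definition gtrace (G B : 'M[R]_n) : R :=
  \sum_a \sum_b invmx G a b * B a b.

(* Index raising: ev2 G (sharp G a) X = a(X) when G is symmetric and
   invertible. *)
Definition sharp (G : 'M[R]_n) (a : 'rV[R]_n) : 'rV[R]_n := a *m invmx G.

Definition odot S T X Y Z W : R :=
  2^-1 * (ev2 T X W * ev2 S Y Z + ev2 T Y Z * ev2 S X W
          - ev2 T X Z * ev2 S Y W - ev2 T Y W * ev2 S X Z).

(* Contraction as a sum over a G-orthonormal basis, the rows of E. *)
Lemma gtraceE (G B E : 'M[R]_n) : E *m G *m E^T = 1%:M ->
  gtrace G B = \sum_i ev2 B (row i E) (row i E).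
Proof.
move=> EGE.
have [/mulmx1_unit[uEG uE'] uE] : E *m G *m E^T = 1%:M /\ E \in unitmx.
  by split=> //; case/mulmx1_unit: EGE => _; rewrite unitmx_tr.
have uG : G \in unitmx by move: uEG; rewrite unitmx_mul => /andP[].
have Ginv : invmx G = E^T *m E.
  apply: (can_inj (mulKmx uG)); rewrite mulmxV // mulmxA.
  apply: (can_inj (mulKmx uE)); rewrite mulmx1 !mulmxA EGE mul1mx //.
have -> : gtrace G B = \tr (E *m B^T *m E^T).
  rewrite mxtrace_mulC mulmxA -Ginv /gtrace /mxtrace.
  by apply: eq_bigr => a _; rewrite mxE; apply: eq_bigr => b _; rewrite mxE.
rewrite -mxtrace_tr !trmx_mul !trmxK mulmxA /mxtrace; apply: eq_bigr => i _.
by rewrite /ev2 tr_row -row_mul [in RHS]mxE [in LHS]mxE;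
   apply: eq_bigr => j _; rewrite !mxE.
Qed.

Lemma ev2_sharp (G : 'M[R]_n) (a X : 'rV[R]_n) : G \in unitmx ->
  ev2 G (sharp G a) X = (a *m X^T) 0 0.
Proof. by move=> uG; rewrite /ev2 /sharp mulmxKV. Qed.

End Tensors.

(** Riemannian geometry in a chart, for a matrix G of metric coefficients.
    Vector fields are functions 'rV_n -> 'rV_n. A tensor is evaluated on
    vectors by extending them to fields with constant components. *)

Section LocalGeometry.
Variables (R : realType) (n : nat) (G : 'rV[R]_n -> 'M[R]_n).
Local Notation vec := 'rV[R]_n.
Local Notation field := (vec -> vec).

(* Levi-Civita connection: the symbol Gamma^k_{ij}. *)
Definition christoffel (x : vec) (k i j : 'I_n) : R :=
  2^-1 * \sum_l invmx (G x) k l *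
    (pd i (fun y => G y j l) x + pd j (fun y => G y i l) x
     - pd l (fun y => G y i j) x).

Definition nabla (X Y : field) : field := fun x =>
  \row_k (dvec (fun y => Y y 0 k) x (X x) +
          \sum_i \sum_j christoffel x k i j * X x 0 i * Y x 0 j).

Definition lie (X Y : field) : field := fun x =>
  \row_k (dvec (fun y => Y y 0 k) x (X x) - dvec (fun y => X y 0 k) x (Y x)).

Definition curv_field (X Y Z W : field) (x : vec) : R :=
  ev2 (G x)
    (nabla X (nabla Y Z) x - nabla Y (nabla X Z) x - nabla (lie X Y) Z x)
    (W x).

Definition curv (x X Y Z W : vec) : R :=
  curv_field (fun=> X) (fun=> Y) (fun=> Z) (fun=> W) x.

Definition Ric (x : vec) : 'M[R]_n := \matrix_(a, b)
  gtrace (G x) (\matrix_(c, d)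
    curv x (basis_vec R a) (basis_vec R c) (basis_vec R d) (basis_vec R b)).

Definition scal (x : vec) : R := gtrace (G x) (Ric x).

(* Hess u (X, Y) = X (Y u) - (nabla_X Y) u *)
Definition Hess (u : vec -> R) (x : vec) : 'M[R]_n := \matrix_(a, b)
  (dvec (fun y => dvec u y (basis_vec R b)) x (basis_vec R a)
   - dvec u x (nabla (fun=> basis_vec R a) (fun=> basis_vec R b) x)).

Definition grad (u : vec -> R) (x : vec) : vec :=
  sharp (G x) (\row_k pd k u x).

(* (nabla_X T)(Y, Z) for a field T of (0,2)-tensors *)
Definition cov_deriv (T : vec -> 'M[R]_n) (x X Y Z : vec) : R :=
  dvec (fun y => ev2 (T y) Y Z) x X
  - ev2 (T x) (nabla (fun=> X) (fun=> Y) x) Z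
  - ev2 (T x) Y (nabla (fun=> X) (fun=> Z) x).

Variables (lambda m : R).

Definition rho (x : vec) : R := (m - 1)^-1 * ((n%:R - 1) * lambda - scal x).

Definition Pten (x : vec) : 'M[R]_n := Ric x - rho x *: G x.

(* The vector P(v) with g(P(v), X) = P(v, X) for all X. *)
Definition Pvec (x v : vec) : vec := sharp (G x) (v *m Pten x).

Definition Qten (x X Y Z W : vec) : R :=
  curv x X Y Z W + 2 / m * odot (Ric x) (G x) X Y Z W
  - (lambda + rho x) / m * odot (G x) (G x) X Y Z W.

End LocalGeometry.

(** Smooth manifolds with boundary, given by an atlas of charts valued in the
    half-space; param c is the inverse of cmap c. *)

Record smooth_manifold (R : realType) (n : nat) := SmoothManifold {
  carrier :> topologicalType;
  manifold_hausdorff : hausdorff_space carrier;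
  manifold_second_countable : @second_countable carrier;
  chart : Type;
  dom : chart -> set carrier;
  cmap : chart -> carrier -> 'rV[R]_n;
  param : chart -> 'rV[R]_n -> carrier;
  dom_open : forall c, open (dom c);
  dom_cover : forall p, exists c, dom c p;
  cmap_image : forall c, exists2 V : set 'rV[R]_n,
    open V & cmap c @` dom c = V `&` @half_space R n;
  cmapK : forall c p, dom c p -> param c (cmap c p) = p;
  cmap_continuous : forall c, {within dom c, continuous (cmap c)};
  param_continuous : forall c, {within cmap c @` dom c, continuous (param c)};
  transition_smooth : forall c d k,
    smooth_on (cmap c @` (dom c `&` dom d))
              (fun x => cmap d (param c x) 0 k)
}.

Section Manifold.
Variables (R : realType) (n : nat) (M : smooth_manifold R n).

Definition img (c : chart M) : set 'rV[R]_n := cmap c @` dom c.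

Definition interior_point (p : M) : Prop :=
  exists2 c : chart M, dom c p & ((@half_space R n)°) (cmap c p).

Definition boundary_point (p : M) : Prop :=
  exists2 c : chart M, dom c p & ~ ((@half_space R n)°) (cmap c p).

Definition smooth_fun (u : M -> R) : Prop :=
  forall c : chart M, smooth_on (img c) (u \o param c).

(* Row-vector convention: components in d are v *m jacobian c d x when those in
   c are v. *)
Definition jacobian (c d : chart M) (x : 'rV[R]_n) : 'M[R]_n :=
  \matrix_(k, l) pd k (fun y => cmap d (param c y) 0 l) x.

(* The components in charts not containing p are irrelevant. *)
Record tangent_vector (p : M) := TangentVector {
  tv_comp :> chart M -> 'rV[R]_n;
  tv_change : forall c d, dom c p -> dom d p ->
    tv_comp d = tv_comp c *m jacobian c d (cmap c p)
}.

Record riemannian_metric := RiemannianMetric {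
  coeff :> chart M -> 'rV[R]_n -> 'M[R]_n;
  coeff_smooth : forall c i j, smooth_on (img c) (fun x => coeff c x i j);
  coeff_sym : forall c x, img c x -> (coeff c x)^T = coeff c x;
  coeff_pos : forall c x v, img c x -> v != 0 -> 0 < ev2 (coeff c x) v v;
  coeff_change : forall c d p, dom c p -> dom d p ->
    coeff c (cmap c p) =
      jacobian c d (cmap c p) *m coeff d (cmap d p)
        *m (jacobian c d (cmap c p))^T
}.

Variable g : riemannian_metric.

Definition velocity (c : chart M) (gam : R -> M) (t : R) : 'rV[R]_n :=
  \row_k derive_within (`[0, 1]%classic : set R^o)
           (fun s : R^o => cmap c (gam s) 0 k) t 1.

(* C^1 curves parametrized by [0, 1] *)
Record C1_curve (gam : R -> M) : Prop := C1Curve {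
  curve_continuous : {within `[0, 1], continuous gam};
  curve_derivable : forall c k (t : R), 0 <= t <= 1 -> dom c (gam t) ->
    derivable_within (`[0, 1]%classic : set R^o)
      (fun s : R^o => cmap c (gam s) 0 k) t 1;
  velocity_continuous : forall c,
    {within `[0, 1]%classic `&` gam @^-1` (dom c), continuous (velocity c gam)}
}.

Definition is_speed (gam : R -> M) (s : R -> R) : Prop :=
  forall (t : R) c, 0 <= t <= 1 -> dom c (gam t) ->
    s t = Num.sqrt (ev2 (g c (cmap c (gam t)))
                        (velocity c gam t) (velocity c gam t)).

(* path_length p q l: some piecewise C^1 path from p to q has length l. *)
Inductive path_length (p : M) : M -> R -> Prop :=
| path_length_nil : path_length p p 0
| path_length_snoc q l gam s :
    path_length p q l -> C1_curve gam -> gam 0 = q -> is_speed gam s ->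
    path_length p (gam 1) (l + \int[lebesgue_measure]_(t in `[0, 1]) s t).

Definition rdist (p q : M) : R := inf [set l | path_length p q l].

Definition complete_metric : Prop := forall u : nat -> M,
  (forall e, 0 < e -> exists N : nat, forall j k : nat,
     (N <= j)%N -> (N <= k)%N -> rdist (u j) (u k) < e) ->
  exists p, forall e, 0 < e -> exists N : nat, forall k : nat,
     (N <= k)%N -> rdist (u k) p < e.

(* (M, g, w) is (lambda, n + m)-Einstein. *)
Record einstein (w : M -> R) (lambda m : R) : Prop := Einstein {
  einstein_connected : connected [set: M];
  einstein_complete : complete_metric;
  einstein_smooth : smooth_fun w;
  einstein_hess : forall (c : chart M) (p : M), dom c p ->
    Hess (g c) (w \o param c) (cmap c p) =
      (w p / m) *: (Ric (g c) (cmap c p) - lambda *: g c (cmap c p));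
  einstein_pos : forall p, interior_point p -> 0 < w p;
  einstein_zero : forall p, boundary_point p -> w p = 0
}.

End Manifold.

(* Main.v *)
From HB Require Import structures.
Require Import Defs.
From mathcomp Require Import all_boot all_order all_algebra.
From mathcomp Require Import all_classical all_reals all_analysis.
From mathcomp Require Import ring.
Import Order.TTheory GRing.Theory Num.Theory numFieldNormedType.Exports.
Local Open Scope classical_set_scope.
Local Open Scope ring_scope.
Set Implicit Arguments.
Unset Strict Implicit.
Unset Printing Implicit Defensive.

(** Differentiating Hess w = (w/m)(Ric - lambda g) and antisymmetrising, the
    Ricci identity turns the left side into curvature applied to grad w, which
    gives a Codazzi equation for Ric. Its metric trace, with the contracted
    second Bianchi identity, gives w d(rho) = 2 P(grad w); substituting this in
    the antisymmetrised derivative of P = Ric - rho g gives the formula, without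
    ever dividing by w, hence also on the boundary.
    In a chart the smooth functions on an open subset of the half-space form a
    commutative ring with commuting derivations, because each has local smooth
    extensions whose partial derivatives give the one-sided ones. The tensor
    calculus is carried out over such a ring, and its identities are evaluated
    at points. *)

(** The trace fixes the shape of rho. Tracing the Codazzi equation turns its curvature side into -m
    Ric(grad w), while the divergence of the tensor on the other side leaves -Ric(grad w) there; the
    difference carries the factor m - 1, which the denominator of rho absorbs because m > 1. The
    contracted Bianchi identity leaves only half of d(scal), which is the origin of the 2 in w
    d(rho) = 2 P(grad w). The ring of smooth functions is not a field and has zero divisors, so
    nothing is divided out: one half, the inverse metric and 1/(m - 1) enter as ring elements with a
    defining equation, and the Einstein equation is multiplied through by m. Its elements are total
    functions, compared at every point of the model space. Every ring identity must therefore also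
    hold off the chart image, and this governs how metric, potential and partial derivatives are
    continued there. *)

Lemma half_add (S : comNzRingType) (h a : S) : 2 * h = 1 -> h * (a + a) = a.
Proof. by move=> h2; rewrite -mulr2n mulrnAr -mulr_natl mulrA h2 mul1r. Qed.

(** * Riemannian geometry over a ring with commuting derivations *)

Section DerivedMatrices.
Variables (S : comNzRingType) (D : {additive S -> S}).
Hypothesis DM : forall a b, D (a * b) = D a * b + a * D b.

Lemma derivation_mulmx p q r (B : 'M[S]_(p, q)) (C : 'M[S]_(q, r)) :
  map_mx D (B *m C) = map_mx D B *m C + B *m map_mx D C.
Proof.
apply/matrixP => i j; rewrite !mxE raddf_sum -big_split.
by apply: eq_bigr => k _; rewrite !mxE DM.
Qed.

Lemma derivation1 : D 1 = 0.
Proof. by apply: (@addrI _ (D 1)); rewrite addr0 -[in RHS](mulr1 1) DM mulr1 mul1r. Qed.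

Lemma derivation_scalar1 p : map_mx D (1%:M : 'M[S]_p) = 0.
Proof.
by apply/matrixP => i j; rewrite !mxE; case: eqP => _ /=; rewrite ?raddf0 ?derivation1.
Qed.

End DerivedMatrices.

(** * The Levi-Civita connection of a symmetric invertible matrix *)

Section MetricAlgebra.
Variables (S : comNzRingType) (n : nat) (D : 'I_n -> {additive S -> S}).
Hypothesis DM : forall k a b, D k (a * b) = D k a * b + a * D k b.
Hypothesis DC : forall k l a, D k (D l a) = D l (D k a).
Variables (half : S) (G H : 'M[S]_n).
Hypothesis half2 : 2 * half = 1.
Hypothesis Gsym : G^T = G.
Hypothesis GH : G *m H = 1%:M.

Local Notation dmx k := (map_mx (D k)).

(** Christoffel symbols of the first kind: entry (j, l) is Gamma_{kj} with its upper index lowered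
    to l. *)
Definition lowered_christoffel (k : 'I_n) : 'M[S]_n :=
  half *: (dmx k G + \matrix_(j, l) D j (G k l) - \matrix_(j, l) D l (G k j)).

(* Entry (j, l) of the connection matrix of index k is the symbol Gamma^l_{kj},
   so that nabla_k Z = D_k Z + Z A_k for a row vector Z. *)
Definition connection_mx (k : 'I_n) : 'M[S]_n := lowered_christoffel k *m H.
Local Notation A := connection_mx.

Lemma GsymE i j : G i j = G j i. Proof. by rewrite -{1}Gsym mxE. Qed.

Lemma HG : H *m G = 1%:M. Proof. exact: mulmx1C. Qed.

Lemma Hsym : H^T = H.
Proof.
have e : H^T *m G = 1%:M by rewrite -{1}Gsym -trmx_mul GH trmx1.
by rewrite -[LHS]mulmx1 -GH mulmxA e mul1mx.
Qed.

Lemma connection_lower k : A k *m G = lowered_christoffel k.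
Proof. by rewrite -mulmxA HG mulmx1. Qed.

(** The two summands are the lowered symbols and their transpose. The part antisymmetric in the
    matrix indices cancels, and half of D_k G occurs twice. *)
Lemma metric_compatible k : dmx k G = A k *m G + G *m (A k)^T.
Proof.
have -> : G *m (A k)^T = (A k *m G)^T by rewrite [in RHS]trmx_mul Gsym.
rewrite connection_lower.
apply/matrixP => i j; rewrite !mxE.
rewrite (GsymE j i) -mulrDr -{1}(half_add (D k (G i j)) half2).
by congr (half * _); ring.
Qed.

Lemma torsion_free k j : row j (A k) = row k (A j).
Proof.
rewrite !row_mul; congr (_ *m H); apply/rowP => l; rewrite !mxE.
by rewrite (GsymE j k); congr (half * _); ring.
Qed.

End MetricAlgebra.

(** * Curvature of a torsion-free metric connection *)

Section CurvatureAlgebra.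
Variables (S : comNzRingType) (n : nat) (D : 'I_n -> {additive S -> S}).
Hypothesis DM : forall k a b, D k (a * b) = D k a * b + a * D k b.
Hypothesis DC : forall k l a, D k (D l a) = D l (D k a).
Variables (half : S) (G H : 'M[S]_n) (A : 'I_n -> 'M[S]_n).
Hypothesis half2 : 2 * half = 1.
Hypothesis Gsym : G^T = G.
Hypothesis GH : G *m H = 1%:M.

Local Notation dmx k := (map_mx (D k)).

Hypothesis metric_compatible : forall k, dmx k G = A k *m G + G *m (A k)^T.
Hypothesis torsion_free : forall k j, row j (A k) = row k (A j).

Let HG : H *m G = 1%:M. Proof. exact: mulmx1C. Qed.

(** Differentiate G H = 1 and multiply by [H] on the left. *)
Lemma inverse_compatible k : dmx k H = - (H *m A k) - (A k)^T *m H.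
Proof.
have : dmx k (G *m H) = 0 by rewrite GH derivation_scalar1.
rewrite derivation_mulmx // metric_compatible => e.
have : H *m (((A k *m G + G *m (A k)^T)) *m H + G *m dmx k H) = 0.
  by rewrite e mulmx0.
rewrite mulmxDl !mulmxDr -!mulmxA GH mulmx1 !(mulmxA H G) HG !mul1mx => /eqP.
by rewrite addrC addr_eq0 => /eqP ->; rewrite opprD.
Qed.

Lemma torsion_freeE k j l : A k j l = A j k l.
Proof. by have /rowP/(_ l) := torsion_free k j; rewrite !mxE. Qed.

(* Entry (b, c) of the curvature matrix is the component c of R(E_k, E_a)E_b. *)
Definition curvature_mx (k a : 'I_n) : 'M[S]_n :=
  dmx k (A a) - dmx a (A k) + A a *m A k - A k *m A a.
Local Notation F := curvature_mx.

Lemma curvature_anti k a : F a k = - F k a.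
Proof.
rewrite /F; move: (dmx k _) (dmx a _) (A a *m _) (A k *m _) => B C P Q.
by apply/matrixP => i j; rewrite !mxE; ring.
Qed.

(** Expand D_k D_a G = D_a D_k G by metric compatibility, twice on each side; what does not cancel
    is the curvature term. *)
Lemma curvature_antisym k a : F k a *m G + G *m (F k a)^T = 0.
Proof.
have eD i j : dmx i (dmx j G) = dmx j (dmx i G).
  by apply/matrixP => p q; rewrite !mxE DC.
have := eD k a; rewrite !metric_compatible !map_mxD !derivation_mulmx // !metric_compatible.
rewrite -!map_trmx !(mulmxDl, mulmxDr) !mulmxA /F.
rewrite !raddfD !raddfN /= !trmx_mul.
rewrite !(mulmxDl, mulmxDr, mulNmx, mulmxN) !mulmxA.
move: (dmx k _ *m G) (dmx a _ *m G) (G *m (dmx k _)^T) (G *m (dmx a _)^T)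
  (A a *m A k *m G) (A k *m A a *m G) (A a *m G *m (A k)^T)
  (A k *m G *m (A a)^T) (G *m (A k)^T *m (A a)^T) (G *m (A a)^T *m (A k)^T).
move=> M1 M2 M3 M4 M5 M6 M7 M8 M9 M10 /eqP; rewrite -subr_eq0 => /eqP e.
rewrite -[RHS]e; apply/matrixP => i j; rewrite !mxE.
ring.
Qed.

(** By torsion-freeness each derivative term and each quadratic term is symmetric in two of its
    indices, so the six of each kind cancel in pairs. *)
Lemma first_bianchi k a b c : F k a b c + F a b k c + F b k a c = 0.
Proof.
have FE i j p q : F i j p q =
    D i (A j p q) - D j (A i p q) + (A j *m A i) p q - (A i *m A j) p q.
  by rewrite /F; move: (A j *m A i) (A i *m A j) => P Q; rewrite !mxE.
have e i j l : (A i *m A j) l c = (A l *m A j) i c.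
  by rewrite !mxE; apply: eq_bigr => s _; rewrite [A i l s]torsion_freeE.
rewrite !FE (torsion_freeE a b) (torsion_freeE k b) (torsion_freeE a k).
rewrite (e a k b) (e k a b) (e a b k).
ring.
Qed.

(** The fully covariant tensor R(E_k, E_a, E_b, E_c). *)
Definition curvature4 k a b c : S := (F k a *m G) b c.
Local Notation Rm := curvature4.

Lemma curvature4_anti12 k a b c : Rm a k b c = - Rm k a b c.
Proof. by rewrite /Rm curvature_anti mulNmx [LHS]mxE. Qed.

Lemma curvature4_anti34 k a b c : Rm k a c b = - Rm k a b c.
Proof.
have /matrixP/(_ b c) := curvature_antisym k a.
rewrite -{2}Gsym -trmx_mul [LHS]mxE [(_^T) b c]mxE [RHS]mxE /Rm addrC => /eqP.
by rewrite addr_eq0 => /eqP.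
Qed.

Lemma curvature4_cyclic k a b c : Rm k a b c + Rm a b k c + Rm b k a c = 0.
Proof.
rewrite /Rm !mxE -!big_split big1 // => j _ /=.
by rewrite -!mulrDl first_bianchi mul0r.
Qed.

Lemma curvature4_pair k a b c : Rm k a b c = Rm b c k a.
Proof.
have h (x y : S) : x + x = y + y -> x = y.
  by move=> e; rewrite -(half_add x half2) -(half_add y half2) e.
have r1 := curvature4_anti12; have r2 := curvature4_anti34.
have c1 := curvature4_cyclic k a b c.
have c2 := curvature4_cyclic a b c k.
have c3 := curvature4_cyclic b c k a.
have c4 := curvature4_cyclic c k a b.
apply: h.
(* Four cyclic identities with signs +, +, -, -: the antisymmetries cancel everything except 2 Rm k
   a b c - 2 Rm b c k a. *)
have : (Rm k a b c + Rm a b k c + Rm b k a c) + (Rm a b c k + Rm b c a k + Rm c a b k)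
  - (Rm b c k a + Rm c k b a + Rm k b c a) - (Rm c k a b + Rm k a c b + Rm a c k b) = 0.
  by rewrite c1 c2 c3 c4 !(subr0, addr0).
have -> : Rm c a b k = Rm a c k b by rewrite r1 r2 opprK.
have -> : Rm k b c a = Rm b k a c by rewrite r1 r2 opprK.
rewrite (r2 a b k c) (r2 b c k a) (r2 c k a b) (r2 k a b c) => e.
by apply/eqP; rewrite -subr_eq0 -e; apply/eqP; ring.
Qed.

(** The covariant derivative nabla_k of the curvature: the commutator with [A k] corrects the
    endomorphism indices, the two sums correct the form indices i and j. *)
Definition dcurvature_mx (k i j : 'I_n) : 'M[S]_n :=
  dmx k (F i j) + F i j *m A k - A k *m F i j
  - \sum_l A k i l *: F l j - \sum_l A k j l *: F i l.
Local Notation DF := dcurvature_mx.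

Lemma dcurvature_anti k i j : DF k j i = - DF k i j.
Proof.
rewrite /DF (curvature_anti i j) map_mxN mulNmx mulmxN.
have e p q : \sum_l A k p l *: F l q = - \sum_l A k p l *: F q l.
  by rewrite -sumrN; apply: eq_bigr => l _; rewrite (curvature_anti q l) scalerN.
rewrite (e j i) (e i j).
move: (dmx k _) (_ *m A k) (A k *m _) (\sum_l _) (\sum_l _) => P Q U V W.
by apply/matrixP => p q; rewrite !mxE; ring.
Qed.

Lemma second_bianchi k i j : DF k i j + DF i j k + DF j k i = 0.
Proof.
(* Torsion-freeness and antisymmetry of [F] make the six form-index corrections cancel in pairs over
   the cyclic sum. *)
have e p q r : \sum_l A p q l *: F l r = - \sum_l A q p l *: F r l.
  rewrite -sumrN; apply: eq_bigr => l _.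
  by rewrite (curvature_anti r l) scalerN torsion_freeE.
rewrite /DF (e k i j) (e i j k) (e j k i).
(* The Bianchi identity of the matrix-valued form: second derivatives cancel since the derivations
   commute, cubic terms by the Jacobi identity. *)
have B : (dmx k (F i j) + F i j *m A k - A k *m F i j) +
    (dmx i (F j k) + F j k *m A i - A i *m F j k) +
    (dmx j (F k i) + F k i *m A j - A j *m F k i) = 0.
  rewrite /F.
  have eD p q r : dmx p (dmx q (A r)) = dmx q (dmx p (A r)).
    by apply/matrixP => x y; rewrite !mxE DC.
  rewrite !(map_mxD, map_mxN).
  rewrite !derivation_mulmx //.
  rewrite (eD k i j) (eD i j k) (eD j k i).
  rewrite !(mulmxDl, mulmxDr).
  rewrite !(mulNmx, mulmxN).
  rewrite !mulmxA.
  move: (dmx i (dmx k _)) (dmx j (dmx i _)) (dmx k (dmx j _)) => M1 M2 M3.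
  repeat match goal with |- context [?X *m ?Y] => move: (X *m Y) => ? end.
  by apply/matrixP => p q; rewrite !mxE; ring.
move: (dmx k _ + _ - _) (dmx i _ + _ - _) (dmx j _ + _ - _) (\sum_l _) (\sum_l _) (\sum_l _) B.
move=> P Q U X Y Z B.
by rewrite -B; apply/matrixP => p q; rewrite !mxE; ring.
Qed.

Lemma dcurvature_antisym k i j : DF k i j *m G + G *m (DF k i j)^T = 0.
Proof.
have : dmx k (F i j *m G + G *m (F i j)^T) = 0.
  by rewrite curvature_antisym; apply/matrixP => p q; rewrite !mxE raddf0.
rewrite map_mxD !derivation_mulmx // !metric_compatible -map_trmx => e.
have Fl p q : F p q *m G = - (G *m (F p q)^T).
  by apply/eqP; rewrite -addr_eq0 curvature_antisym.
have eS (f : 'I_n -> S) (K : 'I_n -> 'M[S]_n) :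
    (forall l, K l *m G = - (G *m (K l)^T)) ->
    (\sum_l f l *: K l) *m G + G *m (\sum_l f l *: K l)^T = 0.
  move=> hK; rewrite raddf_sum /= mulmx_suml mulmx_sumr -big_split big1 // => l _ /=.
  by rewrite linearZ /= -scalemxAl -scalemxAr hK scalerN addNr.
have e1 := eS (A k i) (fun l => F l j) (fun l => Fl l j).
have e2 := eS (A k j) (fun l => F i l) (fun l => Fl i l).
have e0 := curvature_antisym i j; move: e e0 e1 e2; rewrite /DF.
move: (F i j) (\sum_l _) (\sum_l _) => f s1 s2 e e0 e1 e2.
(* The D_k derivative of the antisymmetry relation, minus its four connection corrections; each
   group is already known to vanish. *)
have <- : dmx k f *m G + f *m (A k *m G + G *m (A k)^T) +
    ((A k *m G + G *m (A k)^T) *m f^T + G *m (dmx k f)^T) -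
    A k *m (f *m G + G *m f^T) - (f *m G + G *m f^T) *m (A k)^T -
    (s1 *m G + G *m s1^T) - (s2 *m G + G *m s2^T) = 0.
  by rewrite e e0 e1 e2 mulmx0 mul0mx !subr0.
rewrite !(raddfD, raddfN) /= !trmx_mul !(mulmxDl, mulmxDr, mulNmx, mulmxN) !mulmxA.
repeat match goal with |- context [?X *m ?Y] => move: (X *m Y) => ? end.
by apply/matrixP => p q; rewrite !mxE; ring.
Qed.

Lemma raised_dcurvature_antisym k i j b c :
  (H *m DF k i j) c b = - (H *m DF k i j) b c.
Proof.
have : H *m (DF k i j *m G + G *m (DF k i j)^T) *m H = 0.
  by rewrite dcurvature_antisym mulmx0 mul0mx.
rewrite mulmxDr mulmxDl -!mulmxA GH mulmx1 (mulmxA H G) HG mul1mx => /eqP.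
rewrite addr_eq0 => /eqP/matrixP/(_ c b).
rewrite -{2}(Hsym Gsym GH) -trmx_mul => ->; by rewrite mxE [(_^T) c b]mxE.
Qed.

Let oppmxE (B : 'M[S]_n) i j : (- B) i j = - B i j. Proof. by rewrite mxE. Qed.

Let HsymE i j : H i j = H j i.
Proof. by rewrite -{1}(Hsym Gsym GH) mxE. Qed.

Definition ricci_mx : 'M[S]_n :=
  \matrix_(a, b) \sum_c \sum_d H c d * (F a c *m G) d b.

Definition scalar_curvature : S := \tr (H *m ricci_mx).

Lemma ricci_sym : ricci_mx^T = ricci_mx.
Proof.
apply/matrixP => a b; rewrite !mxE [RHS]exchange_big /=.
apply: eq_bigr => c _; apply: eq_bigr => d _.
rewrite (HsymE c d); congr (_ * _).
rewrite -[LHS]/(curvature4 b c d a) -[RHS]/(curvature4 a d c b).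
by rewrite curvature4_pair curvature4_anti12 curvature4_anti34 opprK.
Qed.

(** The matrix of nabla_k T for a (0,2)-tensor [T]. *)
Definition dtensor (T : 'M[S]_n) (k : 'I_n) : 'M[S]_n :=
  dmx k T - A k *m T - T *m (A k)^T.

Lemma ricciE a b : ricci_mx a b = \sum_c (H *m (F a c *m G)) c b.
Proof. by rewrite mxE; apply: eq_bigr => c _; rewrite [RHS]mxE. Qed.

(** Covariant differentiation commutes with the contraction defining Ric, because G and H are
    parallel; the correction of the summed index c cancels against a term of D_k H, which is [e3]
    below. *)
Lemma dricciE k a b :
  dtensor ricci_mx k a b = \sum_c (H *m (DF k a c *m G)) c b.
Proof.
rewrite /dtensor mxE mxE (_ : dmx k ricci_mx a b =
    \sum_c dmx k (H *m (F a c *m G)) c b); last first.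
  by rewrite [LHS]mxE ricciE raddf_sum; apply: eq_bigr => c _; rewrite [RHS]mxE.
have e1 : (- (A k *m ricci_mx)) a b
    = - \sum_c \sum_l (A k a l *: (H *m (F l c *m G))) c b.
  rewrite mxE mxE exchange_big; congr (- _); apply: eq_bigr => l _.
  by rewrite ricciE mulr_sumr; apply: eq_bigr => c _; rewrite [RHS]mxE.
have e2 : (- (ricci_mx *m (A k)^T)) a b
    = - \sum_c (H *m (F a c *m G) *m (A k)^T) c b.
  rewrite mxE mxE; congr (- _).
  under [RHS]eq_bigr do rewrite mxE.
  rewrite [RHS]exchange_big; apply: eq_bigr => l _.
  by rewrite ricciE mulr_suml.
have e3 : \sum_c ((A k)^T *m H *m (F a c *m G)) c b =
    \sum_c \sum_l (A k c l *: (H *m (F a l *m G))) c b.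
  under eq_bigr do rewrite -mulmxA mxE.
  rewrite exchange_big; apply: eq_bigr => c _; apply: eq_bigr => l _.
  by rewrite [(_^T) _ _]mxE [RHS]mxE.
have -> : \sum_c (H *m (DF k a c *m G)) c b =
    \sum_c ((H *m ((dmx k (F a c) + F a c *m A k - A k *m F a c) *m G)) c b
     - \sum_l (A k a l *: (H *m (F l c *m G))) c b)
    - \sum_c \sum_l (A k c l *: (H *m (F a l *m G))) c b.
  rewrite -sumrB; apply: eq_bigr => c _; rewrite /DF.
  move: (dmx k _ + _ *m A k - A k *m _) => M.
  have es (f : 'I_n -> S) (K : 'I_n -> 'M[S]_n) :
      \sum_l (f l *: (H *m (K l *m G))) c b = (H *m ((\sum_l f l *: K l) *m G)) c b.
    rewrite mulmx_suml mulmx_sumr summxE; apply: eq_bigr => l _.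
    by rewrite -scalemxAl -scalemxAr.
  rewrite (es _ (fun l => F l c)) (es _ (fun l => F a l)).
  move: (\sum_l _) (\sum_l _) => s1 s2; rewrite !(mulmxDl, mulmxDr, mulNmx, mulmxN).
  repeat match goal with |- context [?X *m ?Y] => move: (X *m Y) => ? end.
  by rewrite !mxE; ring.
rewrite e1 e2 -e3 sumrB -!addrA addrCA [RHS]addrCA; congr (_ + _).
rewrite -!sumrN -!big_split; apply: eq_bigr => c _ /=.
move: (F a c) => f.
rewrite !derivation_mulmx // metric_compatible inverse_compatible.
rewrite !(mulmxDl, mulmxDr, mulNmx, mulmxN) !mulmxA.
repeat match goal with |- context [?X *m ?Y] => move: (X *m Y) => ? end.
by rewrite !mxE; ring.
Qed.


Lemma derivative_scalar k : D k scalar_curvature = \tr (H *m dtensor ricci_mx k).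
Proof.
have -> : D k scalar_curvature = \tr (dmx k (H *m ricci_mx)).
  by rewrite raddf_sum; apply: eq_bigr => i _; rewrite [RHS]mxE.
rewrite derivation_mulmx // inverse_compatible /dtensor.
move: ricci_mx => T.
rewrite !(mulmxDl, mulmxDr, mulNmx, mulmxN) !mulmxA !raddfD !raddfN /=.
rewrite [\tr (_ *m (A k)^T)]mxtrace_mulC !mulmxA.
by rewrite addrC !addrA.
Qed.

(** Contract the second Bianchi identity twice: one of its three terms becomes -d(scal), and each of
    the other two becomes the divergence of Ric. *)
Lemma contracted_bianchi k :
  \sum_i \sum_b H i b * dtensor ricci_mx i k b = half * D k scalar_curvature.
Proof.
set t := \sum_i \sum_b _.
pose T k := \sum_i \sum_j (H *m DF i j k) i j.
have anti := raised_dcurvature_antisym.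
have -> : t = T k.
  rewrite /t /T; apply: eq_bigr => i _.
  under eq_bigr do rewrite dricciE mulr_sumr.
  rewrite exchange_big; apply: eq_bigr => c _ /=.
  rewrite (_ : \sum_b _ = (H *m DF i k c *m (G *m H)) c i); last first.
    rewrite !mulmxA -(mulmxA H) mxE; apply: eq_bigr => b _.
    by rewrite (HsymE i) mulrC.
  by rewrite GH mulmx1 anti dcurvature_anti mulmxN oppmxE opprK.
have -> : D k scalar_curvature = T k + T k; last by rewrite half_add.
rewrite derivative_scalar /mxtrace.
have -> : \sum_i (H *m dtensor ricci_mx k) i i = - \sum_i \sum_j (H *m DF k i j) i j.
  under eq_bigr do rewrite mxE.
  rewrite exchange_big -sumrN; apply: eq_bigr => b _ /=.
  under eq_bigr do rewrite dricciE mulr_sumr.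
  rewrite exchange_big -sumrN; apply: eq_bigr => c _ /=.
  rewrite -anti -[in RHS](mulmx1 (H *m _)) -GH !mulmxA -(mulmxA H) [RHS]mxE.
  by apply: eq_bigr => a _; rewrite mulrC.
apply/eqP; rewrite eq_sym -subr_eq0 opprK; apply/eqP.
(* Renaming the summed indices costs two signs, one from the form indices and one from the raised
   pair. *)
have e : T k = \sum_i \sum_j (H *m DF j k i) i j.
  rewrite /T exchange_big; apply: eq_bigr => i _; apply: eq_bigr => j _.
  by rewrite dcurvature_anti mulmxN oppmxE (anti j k i i j) opprK.
rewrite {2}e -!big_split big1 // => i _; rewrite -!big_split big1 // => j _ /=.
have := second_bianchi k i j; move: (DF k i j) (DF i j k) (DF j k i) => P Q U B.
rewrite -[RHS](_ : (H *m (P + Q + U)) i j = 0); last by rewrite B mulmx0 mxE.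
by rewrite !mulmxDr [(H *m P + _ + _) i j]mxE [(H *m P + _) i j]mxE; ring.
Qed.

Lemma dtensor_metric k : dtensor G k = 0.
Proof. by rewrite /dtensor metric_compatible [A k *m G + _]addrC addrK subrr. Qed.

Lemma dtensorZ f T k : dtensor (f *: T) k = D k f *: T + f *: dtensor T k.
Proof.
rewrite /dtensor -scalemxAl -scalemxAr.
have -> : dmx k (f *: T) = D k f *: T + f *: dmx k T.
  by apply/matrixP => i j; rewrite !mxE DM.
by rewrite !scalerBr !addrA.
Qed.

Lemma dtensorB T T' k : dtensor (T - T') k = dtensor T k - dtensor T' k.
Proof.
rewrite /dtensor map_mxB mulmxBr mulmxBl.
repeat match goal with |- context [?X *m ?Y] => move: (X *m Y) => ? end.
by apply/matrixP => i j; rewrite !mxE; ring.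
Qed.

(** * Hessian of the potential and the Codazzi equations *)

Section Potential.
Variable U : S.

Definition hessian_mx : 'M[S]_n :=
  \matrix_(a, b) (D a (D b U) - \sum_l A a b l * D l U).

(** Row i of the Hessian is the covariant derivative of the covector dU along E_i. Torsion-freeness
    removes the corrections of the first slot from the difference, and the remaining commutator of
    covariant derivatives is the curvature. *)
Lemma ricci_identity k a b :
  dtensor hessian_mx k a b - dtensor hessian_mx a k b =
  - \sum_l F k a b l * D l U.
Proof.
pose u : 'rV[S]_n := \row_l D l U.
pose h i := dmx i u - u *m (A i)^T.
have hE i : row i hessian_mx = h i.
  apply/rowP => j; rewrite !mxE; congr (_ - _); apply: eq_bigr => l _.
  by rewrite !mxE mulrC.
have dE i j : dtensor hessian_mx i j b =
    (dmx i (h j)) 0 b - (row j (A i) *m hessian_mx) 0 b - (h j *m (A i)^T) 0 b.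
  rewrite /dtensor mxE oppmxE mxE oppmxE -!hE -row_mul -row_mul.
  by congr (_ - _ - _); rewrite ?mxE.
have -> : \sum_l F k a b l * D l U = (u *m (F k a)^T) 0 b.
  by rewrite mxE; apply: eq_bigr => l _; rewrite [u _ _]mxE [(_^T) _ _]mxE mulrC.
rewrite !dE torsion_free /h !map_mxB !derivation_mulmx // -!map_trmx.
have eD : dmx k (dmx a u) = dmx a (dmx k u).
  by apply/rowP => l; rewrite !mxE DC.
rewrite eD /F !(raddfD, raddfN) /= !trmx_mul !(mulmxDl, mulmxDr, mulNmx, mulmxN) !mulmxA.
repeat match goal with |- context [?X *m ?Y] => move: (X *m Y) => ? end.
by rewrite !mxE; ring.
Qed.

Variables (mS lam : S).
Hypotheses (DmS : forall k, D k mS = 0) (Dlam : forall k, D k lam = 0).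
Hypothesis einstein_hessian : mS *: hessian_mx = U *: (ricci_mx - lam *: G).

(** Apply nabla to [einstein_hessian], where m, lambda and G are all parallel; antisymmetrise, and
    replace the third derivatives of [U] by [ricci_identity]. *)
Lemma codazzi_ricci k a b :
  U * (dtensor ricci_mx k a b - dtensor ricci_mx a k b)
  + D k U * (ricci_mx - lam *: G) a b - D a U * (ricci_mx - lam *: G) k b
  = - (mS * \sum_l F k a b l * D l U).
Proof.
have e i j : mS * dtensor hessian_mx i j b =
    D i U * (ricci_mx - lam *: G) j b + U * dtensor ricci_mx i j b.
  have : dtensor (mS *: hessian_mx) i j b = dtensor (U *: (ricci_mx - lam *: G)) i j b.
    by rewrite einstein_hessian.
  rewrite !dtensorZ dtensorB dtensorZ dtensor_metric DmS Dlam.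
  move: (ricci_mx - lam *: G) (dtensor _ _) (dtensor _ _) => T T1 T2.
  by rewrite scaler0 !scale0r !addr0 subr0 add0r !mxE.
rewrite -[in RHS]mulrN -ricci_identity [in RHS]mulrBr !e; ring.
Qed.

Definition gradient_row : 'rV[S]_n := (\row_l D l U) *m H.

Lemma lower_gradient : gradient_row *m G = \row_l D l U.
Proof. by rewrite -mulmxA HG mulmx1. Qed.

(** Identifies the metric trace over a, b of the curvature term in [codazzi_ricci]. *)
Lemma ricci_gradient k :
  (gradient_row *m ricci_mx) 0 k = \sum_a \sum_b H a b * \sum_l F k a b l * D l U.
Proof.
rewrite -ricci_sym mxE.
under eq_bigr do rewrite [(_^T) _ _]mxE ricciE mulr_sumr.
rewrite exchange_big; apply: eq_bigr => a _ /=.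
have e : (H *m (F k a *m G) *m gradient_row^T) a 0 = (H *m (F k a *m (\row_l D l U)^T)) a 0.
  by rewrite -lower_gradient [in RHS]trmx_mul Gsym !mulmxA.
rewrite mxE in e; under eq_bigr do rewrite mulrC.
have -> : \sum_b H a b * (\sum_l F k a b l * D l U) = (H *m (F k a *m (\row_l D l U)^T)) a 0.
  rewrite mxE; apply: eq_bigr => b _; rewrite [in RHS]mxE; congr (_ * _).
  by apply: eq_bigr => l _; rewrite !mxE.
by rewrite -e; apply: eq_bigr => b _; rewrite [gradient_row^T _ _]mxE.
Qed.

Lemma derivative_scalar_potential k :
  U * D k scalar_curvature =
  2 * ((1 - mS) * (gradient_row *m ricci_mx) 0 k
       - D k U * (scalar_curvature - (n%:R - 1) * lam)).
Proof.
have tr (T : 'M[S]_n) : \sum_a \sum_b H a b * T a b = \tr (H *m T).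
  rewrite exchange_big /mxtrace; apply: eq_bigr => b _; rewrite mxE.
  by apply: eq_bigr => a _; rewrite HsymE.
have e : \sum_a \sum_b H a b * (U * (dtensor ricci_mx k a b - dtensor ricci_mx a k b)
  + D k U * (ricci_mx - lam *: G) a b - D a U * (ricci_mx - lam *: G) k b)
  = - (mS * (gradient_row *m ricci_mx) 0 k).
  rewrite ricci_gradient mulr_sumr -sumrN; apply: eq_bigr => a _.
  rewrite mulr_sumr -sumrN; apply: eq_bigr => b _.
  by rewrite codazzi_ricci; ring.
(* The traced Codazzi equation. The trace of G gives n lambda D_k U, and the last term gives one
   lambda D_k U back, whence n - 1. *)
have e' : U * (D k scalar_curvature - half * D k scalar_curvature)
    + D k U * (scalar_curvature - lam * n%:R)
    - ((gradient_row *m ricci_mx) 0 k - lam * D k U)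
  = - (mS * (gradient_row *m ricci_mx) 0 k).
  rewrite -e -contracted_bianchi derivative_scalar -tr.
  have -> : scalar_curvature - lam * n%:R = \sum_a \sum_b H a b * (ricci_mx - lam *: G) a b.
    by rewrite tr mulmxBr raddfB /= -scalemxAr HG mxtraceZ mxtrace1.
  have -> : (gradient_row *m ricci_mx) 0 k - lam * D k U =
      \sum_a \sum_b H a b * (D a U * (ricci_mx - lam *: G) k b).
    have -> : lam * D k U = (lam *: (gradient_row *m G)) 0 k.
      by rewrite lower_gradient !mxE.
    have -> (x y : 'rV[S]_n) : x 0 k - y 0 k = (x - y) 0 k by rewrite !mxE.
    rewrite scalemxAr -mulmxBr mxE exchange_big; apply: eq_bigr => b _ /=.
    rewrite [gradient_row _ _]mxE mulr_suml; apply: eq_bigr => a _.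
    have -> : (ricci_mx - lam *: G) k b = (ricci_mx - lam *: G) b k.
      rewrite -[in LHS]ricci_sym -[in LHS]Gsym; move: ricci_mx => T; by rewrite !mxE.
    by rewrite mxE mulrA [_ * H a b]mulrC.
  rewrite !mulr_sumr -sumrB mulr_sumr -!big_split -sumrB; apply: eq_bigr => a _ /=.
  rewrite !mulr_sumr -sumrB mulr_sumr -!big_split -sumrB; apply: eq_bigr => b _ /=.
  ring.
have h1 : D k scalar_curvature - half * D k scalar_curvature = half * D k scalar_curvature.
  by rewrite -{1}(half_add (D k scalar_curvature) half2) mulrDr addrK.
rewrite h1 in e'.
transitivity (2 * (U * (half * D k scalar_curvature))).
  by rewrite -{1}(half_add (D k scalar_curvature) half2); ring.
congr (2 * _); apply/eqP; rewrite -subr_eq0; apply/eqP.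
move/eqP: e'; rewrite -subr_eq0 => /eqP <-; ring.
Qed.

Variables (r : S).
Hypotheses (Dr : forall k, D k r = 0) (rE : r * (mS - 1) = 1).

Definition rho_fun : S := r * ((n%:R - 1) * lam - scalar_curvature).

Lemma derivation_nat k i : D k i%:R = 0.
Proof. by rewrite raddfMn /= derivation1 // mul0rn. Qed.

(** The right side is 2 P(grad U). Multiplying by -r turns the coefficient 1 - m of Ric(grad U) into
    1 and reassembles the remaining terms into [rho_fun] itself. *)
Lemma derivative_rho k :
  U * D k rho_fun = 2 * ((gradient_row *m ricci_mx) 0 k - rho_fun * D k U).
Proof.
rewrite /rho_fun DM Dr raddfB DM raddfB /= derivation_nat (derivation1 (@DM k)) Dlam.
transitivity (- r * (U * D k scalar_curvature)); first ring.
rewrite derivative_scalar_potential; move: (_ 0 k) => x.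
have {2}-> : x = r * (mS - 1) * x by rewrite rE mul1r.
ring.
Qed.

Definition P_mx : 'M[S]_n := ricci_mx - rho_fun *: G.

(** Since [U] times d(rho) is 2 P(grad U), no derivative of [rho_fun] is left on the right. *)
Lemma codazzi_P k a b :
  U * (dtensor P_mx k a b - dtensor P_mx a k b) =
  - (mS * \sum_l F k a b l * D l U)
  - D k U * (ricci_mx - lam *: G) a b + D a U * (ricci_mx - lam *: G) k b
  - 2 * (gradient_row *m P_mx) 0 k * G a b
  + 2 * (gradient_row *m P_mx) 0 a * G k b.
Proof.
have e i j : dtensor P_mx i j b = dtensor ricci_mx i j b - D i rho_fun * G j b.
  rewrite dtensorB dtensorZ dtensor_metric scaler0 addr0.
  by move: (dtensor _ _) => T; rewrite !mxE.
have gP i : 2 * (gradient_row *m P_mx) 0 i = U * D i rho_fun.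
  rewrite derivative_rho mulmxBr -scalemxAr lower_gradient; congr (_ * _).
  by move: (gradient_row *m _) => x; rewrite !mxE.
rewrite !e !gP -codazzi_ricci; ring.
Qed.

End Potential.

End CurvatureAlgebra.

(** * Smooth functions on a relatively open subset of the half-space *)

Section MixedDerivatives.
Variables (R : realType) (E : normedModType R).

Lemma is_derive_line (f : E -> R) (p v : E) (s : R) :
  derivable f (s *: v + p) v ->
  is_derive s 1 (fun t : R => f (t *: v + p)) ('D_v f (s *: v + p)).
Proof.
move=> df; set q := s *: v + p.
pose f1 := fun t : R => f (t *: v + p).
have e : (fun h : R => h^-1 *: ((f1 \o shift s) (h *: 1) - f1 s)) =
         (fun h : R => h^-1 *: ((f \o shift q) (h *: v) - f q)).
  by apply/funext => h; rewrite /f1 /= [h *: 1]mulr1 scalerDl -addrA.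
by split; [rewrite /derivable e|rewrite /derive e].
Qed.

Lemma mvt_line (f : E -> R) (p v : E) (h : R) : 0 < h ->
  (forall s, 0 <= s <= h -> derivable f (s *: v + p) v) ->
  exists2 s, 0 < s < h & f (h *: v + p) - f p = h * 'D_v f (s *: v + p).
Proof.
move=> h0 df.
have dl s : 0 <= s <= h ->
    is_derive s 1 (fun t : R => f (t *: v + p)) ('D_v f (s *: v + p)).
  by move=> sh; exact/is_derive_line/df.
have [||s] := @MVT R (fun t : R => f (t *: v + p))
    (fun t => 'D_v f (t *: v + p)) 0 h h0.
- by move=> s; rewrite in_itv /= => /andP[s0 sh]; apply: dl; rewrite !ltW.
- apply: derivable_within_continuous => s; rewrite in_itv /= => sh.
  by have [] := dl s sh.
rewrite in_itv /= => sh; rewrite scale0r add0r subr0 mulrC => e.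
by exists s.
Qed.

(** The mean value theorem along u for the increment of f in direction hv, then along v for the
    derivative of f along u. *)
Lemma second_difference (f : E -> R) (x u v : E) (h : R) : 0 < h ->
  (forall s t, 0 <= s <= h -> 0 <= t <= h ->
     derivable f (s *: u + (t *: v + x)) u) ->
  (forall s t, 0 <= s <= h -> 0 <= t <= h ->
     derivable ('D_u f) (s *: u + (t *: v + x)) v) ->
  exists s t, [/\ 0 < s < h, 0 < t < h &
    f (h *: u + (h *: v + x)) - f (h *: v + x) - (f (h *: u + x) - f x) =
    h * (h * 'D_v ('D_u f) (s *: u + (t *: v + x)))].
Proof.
move=> h0 du dvu.
have h01 : 0 <= h <= h by rewrite lexx ltW.
have h00 : 0 <= (0 : R) <= h by rewrite lexx ltW.
pose g y := f (h *: v + y) - f y.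
have sh (c : E) (y w : E) : derivable f (c + y) w ->
    is_derive y w (fun z => f (c + z)) ('D_w f (c + y)).
  move=> df.
  have e : (fun k : R => k^-1 *: (((fun z => f (c + z)) \o shift y) (k *: w) - f (c + y))) =
           (fun k : R => k^-1 *: ((f \o shift (c + y)) (k *: w) - f (c + y))).
    by apply/funext => k /=; rewrite addrCA.
  by split; [rewrite /derivable e|rewrite /derive e].
have dg s : 0 <= s <= h ->
    is_derive (s *: u + x) u g ('D_u f (h *: v + (s *: u + x)) - 'D_u f (s *: u + x)).
  move=> s01; apply: is_deriveB.
    by apply: sh; rewrite (addrCA (h *: v)); apply: du.
  by apply: derivableP; have := du s 0 s01 h00; rewrite scale0r add0r.
have [|s s0h es] := @mvt_line g x u h h0.
  by move=> s /dg[].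
have s01 : 0 <= s <= h by case/andP: s0h => *; rewrite !ltW.
have [|t t0h et] := @mvt_line ('D_u f) (s *: u + x) v h h0.
  by move=> t t01; rewrite (addrCA (t *: v)); apply: dvu.
exists s, t; split => //.
have [_ dgE] := dg s s01.
rewrite (addrCA (s *: u) (t *: v) x) -et -dgE -es /g (addrCA (h *: u) (h *: v) x); ring.
Qed.

Lemma schwarz (f : E -> R) (x u v : E) (V : set E) : open V -> V x ->
  (forall y, V y -> derivable f y u) -> (forall y, V y -> derivable f y v) ->
  (forall y, V y -> derivable ('D_u f) y v) ->
  (forall y, V y -> derivable ('D_v f) y u) ->
  {for x, continuous ('D_v ('D_u f))} -> {for x, continuous ('D_u ('D_v f))} ->
  'D_v ('D_u f) x = 'D_u ('D_v f) x.
Proof.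
move=> oV Vx du dv dvu duv cvu cuv.
apply/eqP; rewrite -subr_eq0 -normr_eq0 -[_ == 0]negbK -normr_gt0 normr_id.
apply/negP => e0; set e := `|_| in e0.
have e2 : 0 < e / 2 by rewrite divr_gt0.
have Vn : nbhs x V by exact: open_nbhs_nbhs.
have n1 : \forall y \near x, `|'D_v ('D_u f) x - 'D_v ('D_u f) y| < e / 2.
  by move/cvgr_dist_lt: cvu; apply.
have n2 : \forall y \near x, `|'D_u ('D_v f) x - 'D_u ('D_v f) y| < e / 2.
  by move/cvgr_dist_lt: cuv; apply.
have /nbhs_ballP[d /= d0 Hd] : \forall y \near x, [/\ V y,
    `|'D_v ('D_u f) x - 'D_v ('D_u f) y| < e / 2 &
    `|'D_u ('D_v f) x - 'D_u ('D_v f) y| < e / 2].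
  by apply: filterS3 Vn n1 n2 => y.
(* The summand 1 keeps c positive when u = v = 0; with h = d / (2c) the whole parallelogram lies
   within d / 2 of x. *)
pose c := `|u| + `|v| + 1.
have c0 : 0 < c by rewrite ltr_wpDl // addr_ge0.
pose h := d / (2 * c).
have h0 : 0 < h by rewrite divr_gt0 // mulr_gt0.
have box s t : 0 <= s <= h -> 0 <= t <= h -> ball x d (s *: u + (t *: v + x)).
  move=> /andP[s0 sh] /andP[t0 th]; rewrite -ball_normE /= addrA addrC.
  rewrite opprD addNKr normrN.
  apply: (@le_lt_trans _ _ (h * c)).
    rewrite (le_trans (ler_normD _ _)) // !normrZ !ger0_norm // /c mulrDr mulr1.
    rewrite mulrDr ler_wpDr ?(ltW h0) // lerD // ler_wpM2r //.
  rewrite /h invfM mulrA -(mulrA _ _ c) mulVf ?gt_eqF // mulr1.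
  by rewrite ltr_pdivrMr // mulr_natr mulr2n ltrDl.
have [||s1 [t1 [s1h t1h E1]]] := @second_difference f x u v h h0.
- by move=> s t sh th; apply: du; case: (Hd _ (box s t sh th)).
- by move=> s t sh th; apply: dvu; case: (Hd _ (box s t sh th)).
have [||s2 [t2 [s2h t2h E2]]] := @second_difference f x v u h h0.
- by move=> s t sh th; apply: dv; rewrite (addrCA (s *: v)); case: (Hd _ (box t s th sh)).
- by move=> s t sh th; apply: duv; rewrite (addrCA (s *: v)); case: (Hd _ (box t s th sh)).
have le2 (s : R) : 0 < s < h -> 0 <= s <= h by case/andP=> *; rewrite !ltW.
have [_ Q1 _] := Hd _ (box _ _ (le2 _ s1h) (le2 _ t1h)).
have [_ _ ] := Hd _ (box _ _ (le2 _ t2h) (le2 _ s2h)).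
rewrite (addrCA (t2 *: u)) => Q2.
have hn0 : h != 0 by rewrite gt_eqF.
(* The second difference is symmetric in u and v, so the two mixed derivatives agree at intermediate
   points, each within e / 2 of its value at x. *)
have EE : 'D_v ('D_u f) (s1 *: u + (t1 *: v + x)) =
          'D_u ('D_v f) (s2 *: v + (t2 *: u + x)).
  apply: (mulfI hn0); apply: (mulfI hn0).
  apply: etrans (esym E1) _; apply: etrans E2; rewrite (addrCA (h *: u) (h *: v) x).
  by move: (f _) (f _) (f _) (f _) => a1 a2 a3 a4; ring.
rewrite -EE in Q2.
suff : e < e by rewrite ltxx.
rewrite {1}/e; move: Q1 Q2 {E1 E2 EE}.
move: ('D_v ('D_u f) (s1 *: u + _)) ('D_v ('D_u f) x) ('D_u ('D_v f) x) => q a b Q1 Q2.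
have -> : a - b = (a - q) - (b - q) by ring.
by rewrite (le_lt_trans (ler_normB _ _)) // [ltRHS]splitr ltrD.
Qed.

End MixedDerivatives.

(** * Closure of smoothness under ring operations and inversion *)

Section SmoothClosure.
Variables (R : realType) (n : nat).
Implicit Types (V A : set 'rV[R]_n) (F K f g : 'rV[R]_n -> R).

Lemma open_near V x (P : 'rV[R]_n -> Prop) : open V -> V x ->
  (forall y, V y -> P y) -> \forall y \near x, P y.
Proof.
move=> oV Vx VP; have nV : nbhs x V by exact: open_nbhs_nbhs.
by apply: filterS nV.
Qed.

Lemma CrS r V F : Cr r.+1 V F -> Cr r V F.
Proof.
elim: r F => [|r IH] F [cF dF]; split=> // k.
by have [dk Ck] := dF k; split=> //; apply: IH.
Qed.

Lemma Cr_continuous r V F x : Cr r V F -> V x -> {for x, continuous F}.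
Proof. by case: r => [|r] [cF _]; apply: cF. Qed.

Lemma Cr_subset r V V' F : V' `<=` V -> Cr r V F -> Cr r V' F.
Proof.
move=> VV'; elim: r F => [|r IH] F [cF dF].
  by split=> // x /VV'/cF.
split=> [x /VV'/cF //|k]; have [dk Ck] := dF k.
by split=> [x /VV'/dk //|]; apply: IH.
Qed.

Lemma eq_Cr r V F K : open V -> (forall x, V x -> F x = K x) ->
  Cr r V F -> Cr r V K.
Proof.
move=> oV; elim: r F K => [|r IH] F K FK [cF dF].
  split=> // x Vx; have FKx := open_near oV Vx FK.
  have cFx : F @ x --> F x := cF x Vx.
  rewrite (FK _ Vx) in cFx; apply: cvg_trans cFx.
  exact: (@near_eq_cvg _ _ (nbhs x) (nbhs_filter x) _ _ FKx).
split=> [x Vx|k].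
  have FKx := open_near oV Vx FK.
  have cFx : F @ x --> F x := cF x Vx.
  rewrite (FK _ Vx) in cFx; apply: cvg_trans cFx.
  exact: (@near_eq_cvg _ _ (nbhs x) (nbhs_filter x) _ _ FKx).
have [dk Ck] := dF k; split=> [x Vx|].
  by apply: near_eq_derivable (dk x Vx); exact: open_near oV Vx FK.
apply: IH Ck => x Vx; apply: near_eq_derive; exact: open_near oV Vx FK.
Qed.

Lemma Cr_cst r V (c : R) : Cr r V (cst c).
Proof.
elim: r c => [|r IH] c; first by split=> // x _; exact: cst_continuous.
split=> [x _|k]; first exact: cst_continuous.
split=> [x _|]; first exact: derivable_cst.
rewrite (_ : (fun x => _) = cst 0); first exact: IH.
by apply/funext => x; rewrite derive_cst.
Qed.

Lemma CrD r V F K : open V -> Cr r V F -> Cr r V K -> Cr r V (F \+ K).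
Proof.
move=> oV; elim: r F K => [|r IH] F K [cF dF] [cK dK].
  by split=> // x Vx; apply: continuousD; [exact: cF|exact: cK].
split=> [x Vx|k]; first by apply: continuousD; [exact: cF|exact: cK].
have [dFk CF] := dF k; have [dKk CK] := dK k; split=> [x Vx|].
  by apply: derivableD; [exact: dFk|exact: dKk].
apply: eq_Cr (IH _ _ CF CK) => // x Vx /=.
by rewrite [RHS]deriveD //; [exact: dFk|exact: dKk].
Qed.

Lemma CrM r V F K : open V -> Cr r V F -> Cr r V K -> Cr r V (F \* K).
Proof.
move=> oV; elim: r F K => [|r IH] F K CrF CrK; have [cF dF] := CrF; have [cK dK] := CrK.
  by split=> // x Vx; apply: continuousM; [exact: cF|exact: cK].
split=> [x Vx|k]; first by apply: continuousM; [exact: cF|exact: cK].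
have [dFk CF] := dF k; have [dKk CK] := dK k; split=> [x Vx|].
  by apply: derivableM; [exact: dFk|exact: dKk].
apply: eq_Cr (CrD oV (IH _ _ (CrS CrF) CK) (IH _ _ (CrS CrK) CF)) => // x Vx /=.
by rewrite [RHS]deriveM //; [exact: dFk|exact: dKk].
Qed.

(** The derivative of 1/F is -(1/F)(1/F) times that of F, so the induction only needs 1/F at the
    lower order. *)
Lemma CrV r V F : open V -> (forall x, V x -> F x != 0) -> Cr r V F ->
  Cr r V (fun x => (F x)^-1).
Proof.
move=> oV F0; elim: r F F0 => [|r IH] F F0 CrF; have [cF dF] := CrF.
  by split=> // x Vx; have cFx : F @ x --> F x := cF x Vx; exact: (cvgV (F0 x Vx) cFx).
split=> [x Vx|k]; first by have cFx : F @ x --> F x := cF x Vx; exact: (cvgV (F0 x Vx) cFx).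
have [dFk CF] := dF k; split=> [x Vx|].
  by apply: (derivableV (F0 x Vx)); exact: dFk.
have CV := IH _ F0 (CrS CrF).
apply: eq_Cr (CrM oV (Cr_cst r V (-1)) (CrM oV (CrM oV CV CV) CF)) => // x Vx /=.
by rewrite (deriveV (F0 x Vx) (dFk x Vx)) mulN1r -exprVn expr2 -mulNr.
Qed.

Lemma smooth_on_cst A (c : R) : smooth_on A (cst c).
Proof. by move=> x Ax; exists setT, (cst c); split=> // [|r]; [exact: openT|exact: Cr_cst]. Qed.

Lemma smooth_onD A f g : smooth_on A f -> smooth_on A g -> smooth_on A (f \+ g).
Proof.
move=> sf sg x Ax.
have [V [F [oV Vx CF Ff]]] := sf x Ax; have [W [K [oW Wx CK Kg]]] := sg x Ax.
have oVW : open (V `&` W) by exact: openI.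
exists (V `&` W), (F \+ K); split=> // [r|y [Vy Wy] Ay /=]; last by rewrite Ff ?Kg.
by apply: CrD => //; [apply: Cr_subset (CF r)|apply: Cr_subset (CK r)] => y [].
Qed.

Lemma smooth_onM A f g : smooth_on A f -> smooth_on A g -> smooth_on A (f \* g).
Proof.
move=> sf sg x Ax.
have [V [F [oV Vx CF Ff]]] := sf x Ax; have [W [K [oW Wx CK Kg]]] := sg x Ax.
have oVW : open (V `&` W) by exact: openI.
exists (V `&` W), (F \* K); split=> // [r|y [Vy Wy] Ay /=]; last by rewrite Ff ?Kg.
by apply: CrM => //; [apply: Cr_subset (CF r)|apply: Cr_subset (CK r)] => y [].
Qed.

Lemma smooth_onV A f : (forall x, A x -> f x != 0) -> smooth_on A f ->
  smooth_on A (fun x => (f x)^-1).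
Proof.
move=> f0 sf x Ax; have [V [F [oV Vx CF Ff]]] := sf x Ax.
have Fx0 : F x != 0 by rewrite Ff ?f0.
have cF : {for x, continuous F} by exact: Cr_continuous (CF 0%N) Vx.
have nV : nbhs x V by exact: open_nbhs_nbhs.
(* The extension may vanish off A although f does not vanish on A, so its domain is shrunk. *)
have n0 : \forall y \near x, V y /\ F y != 0.
  near=> y; split; first by near: y.
  near: y; have : nbhs (F x) [set z | z != 0] by apply: open_nbhs_nbhs; split=> //; exact: open_neq.
  exact: cF.
have [W [oW Wx WV]] : exists W, [/\ open W, W x & W `<=` [set y | V y /\ F y != 0]].
  exists ([set y | V y /\ F y != 0]°)%classic; split; [exact: open_interior|exact: n0|].
  exact: interior_subset.
exists W, (fun y => (F y)^-1); split=> // [r|y Wy Ay].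
  apply: CrV => // [y /WV[] //|]; apply: Cr_subset (CF r) => y /WV[] //.
by rewrite Ff //; case: (WV _ Wy).
Unshelve. all: by end_near. Qed.

Lemma eq_smooth_on A f g : (forall x, A x -> f x = g x) ->
  smooth_on A f -> smooth_on A g.
Proof.
move=> fg sf x Ax; have [V [F [oV Vx CF Ff]]] := sf x Ax.
by exists V, F; split=> // y Vy Ay; rewrite Ff ?fg.
Qed.

End SmoothClosure.

(** * One-sided partial derivatives through extensions *)

Section HalfSpaceDerivative.
Variables (R : realType) (n : nat) (O : set 'rV[R]_n).
Hypothesis oO : open O.
Let A := O `&` @half_space R n.
Implicit Types (f g F : 'rV[R]_n -> R).

(** Moving by a positive h along a coordinate vector never leaves the half-space, even from its
    boundary; properness makes the one-sided limit unique. *)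
Lemma within_dir_proper x (k : 'I_n) : half_space x ->
  ProperFilter (within_dir (@half_space R n) x (basis_vec R k)).
Proof.
move=> hx; rewrite /within_dir; apply: Build_ProperFilter_ex.
move=> P; rewrite /within /= => /nbhs_ballP[e /= e0 HP].
exists (e / 2); apply: HP.
- rewrite -ball_normE /= sub0r normrN gtr0_norm ?divr_gt0 //.
  by rewrite ltr_pdivrMr // mulr_natr mulr2n ltrDl.
- by rewrite gt_eqF // divr_gt0.
- move=> j j0; rewrite !mxE addr_ge0 ?hx // mulr_ge0 ?ler0n //.
  by rewrite divr_ge0 // ltW.
Qed.

(** The quotients of f and F agree for small admissible h, and the two-sided limit for F restricts
    to the coarser set of directions that stay in the half-space. *)
Lemma pd_extension f F V x (k : 'I_n) : open V -> V x -> A x ->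
  (forall y, V y -> A y -> F y = f y) -> derivable F x (basis_vec R k) ->
  pd k f x = 'D_(basis_vec R k) F x.
Proof.
move=> oV Vx [Ox hx] Ff dF; have PF := @within_dir_proper x k hx.
apply: cvg_lim => //.
have cF : (fun h => h^-1 *: ((F \o shift x) (h *: basis_vec R k) - F x)) @
    within_dir (@half_space R n) x (basis_vec R k) --> 'D_(basis_vec R k) F x.
  by apply: cvg_trans dF; apply: cvg_app; apply: cvg_within.
apply: cvg_trans cF; apply: near_eq_cvg.
have nVO : nbhs x (V `&` O) by apply: open_nbhs_nbhs; split=> //; exact: openI.
have cont : continuous (fun h : R => x + h *: basis_vec R k).
  by move=> h; apply: cvgD; [exact: cst_continuous|exact: scalel_continuous].
have cl : (fun h : R => x + h *: basis_vec R k) @ (0 : R) --> x.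
  by have := cont 0; rewrite /continuous_at scale0r addr0.
have n0 : \forall h \near (0 : R), (V `&` O) (x + h *: basis_vec R k) by exact: cl.
rewrite /within_dir near_withinE.
have n1 : \forall h \near 0^', (V `&` O) (x + h *: basis_vec R k).
  exact: cvg_within n0.
move: n1; apply: filterS => h [Vh Oh] hh; rewrite /dquot /= [h *: _ + x]addrC.
by rewrite Ff // Ff.
Qed.

End HalfSpaceDerivative.

(** * The ring of smooth functions and its evaluations *)

Section SmoothFunctions.
Variables (R : realType) (n : nat) (A : set 'rV[R]_n).

Definition smooth_pred : {pred 'rV[R]_n -> R} := [pred f | `[< smooth_on A f >]].

Lemma smooth_subring : subring_closed smooth_pred.
Proof.
split=> [|f g|f g]; rewrite ?inE.
- exact: smooth_on_cst.
- move=> sf sg; have sN := smooth_onM (@smooth_on_cst R n A (-1)) sg.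
  apply: eq_smooth_on (smooth_onD sf sN) => x _ /=.
  by rewrite mulN1r.
- by move=> sf sg; apply: smooth_onM.
Qed.

HB.instance Definition _ :=
  GRing.isSubringClosed.Build ('rV[R]_n -> R) smooth_pred smooth_subring.

(** Total functions with unconstrained values off A. Evaluation is then a ring morphism at every
    point, but equality also compares the values off A. *)
Record smooth_fn := SmoothFn {
  smooth_val :> 'rV[R]_n -> R;
  _ : smooth_val \in smooth_pred
}.

HB.instance Definition _ := [isSub for smooth_val].
HB.instance Definition _ := [Choice of smooth_fn by <:].
HB.instance Definition _ := [SubChoice_isSubComNzRing of smooth_fn by <:].

Lemma smooth_fnP (f : smooth_fn) : smooth_on A f.
Proof. by case: f => f /=; rewrite inE. Qed.

Lemma smooth_fn_eq (f g : smooth_fn) : (forall x, f x = g x) -> f = g.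
Proof. by move=> fg; apply: val_inj; apply/funext. Qed.

Definition mk_smooth f (sf : smooth_on A f) : smooth_fn :=
  SmoothFn (introT (asboolP _) sf).

Definition ev (x : 'rV[R]_n) (f : smooth_fn) : R := f x.

Lemma ev_is_zmod_morphism x : zmod_morphism (ev x).
Proof. by []. Qed.

Lemma ev_is_monoid_morphism x : monoid_morphism (ev x).
Proof. by []. Qed.

HB.instance Definition _ x :=
  GRing.isZmodMorphism.Build smooth_fn R (ev x) (ev_is_zmod_morphism x).
HB.instance Definition _ x :=
  GRing.isMonoidMorphism.Build smooth_fn R (ev x) (ev_is_monoid_morphism x).

End SmoothFunctions.

(** * Partial derivatives as commuting derivations *)

Section SmoothDerivations.
Variables (R : realType) (n : nat) (O : set 'rV[R]_n).
Hypothesis oO : open O.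
Let A := O `&` @half_space R n.
Implicit Types (f g : smooth_fn A) (k l : 'I_n).

Lemma pd_smooth f x V F k : open V -> V x -> (forall r, Cr r V F) ->
  (forall y, V y -> A y -> F y = f y) -> A x ->
  pd k f x = 'D_(basis_vec R k) F x.
Proof.
move=> oV Vx CF Ff Ax; apply: (pd_extension oO oV Vx Ax Ff).
by have [_ /(_ k)[dF _]] := CF 1%N; apply: dF.
Qed.

(** Near a point of A the half-space and A coincide, as [O] is open; hence chart quantities may be
    replaced by ring elements that agree with them on A only. *)
Lemma eq_pd f (h : 'rV[R]_n -> R) x k : (forall y, A y -> h y = f y) -> A x ->
  pd k h x = pd k f x.
Proof.
move=> hf Ax; have [V [F [oV Vx CF Ff]]] := smooth_fnP f Ax.
rewrite (pd_smooth k oV Vx CF Ff Ax); apply: (pd_extension oO oV Vx Ax).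
  by move=> y Vy Ay; rewrite Ff ?hf.
by have [_ /(_ k)[dF _]] := CF 1%N; apply: dF.
Qed.

(* The value 0 off A makes the Leibniz rule and the symmetry of second
   derivatives hold as equalities of functions on the whole space. *)
Definition deriv_val k f (x : 'rV[R]_n) : R := if x \in A then pd k f x else 0.

Lemma deriv_valE k f x : A x -> deriv_val k f x = pd k f x.
Proof. by move=> Ax; rewrite /deriv_val mem_set. Qed.

Lemma deriv_val_smooth k f : smooth_on A (deriv_val k f).
Proof.
move=> x Ax; have [V [F [oV Vx CF Ff]]] := smooth_fnP f Ax.
exists V, ('D_(basis_vec R k) F); split=> // [r|y Vy Ay].
  by have [_ /(_ k)[_ +]] := CF r.+1; apply.
by rewrite deriv_valE // (pd_smooth k oV Vy CF Ff Ay).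
Qed.

Definition deriv k f : smooth_fn A := mk_smooth (@deriv_val_smooth k f).

Lemma derivE k f x : A x -> deriv k f x = pd k f x.
Proof. exact: deriv_valE. Qed.

Lemma deriv_out k f x : ~ A x -> deriv k f x = 0.
Proof. by move=> nAx; rewrite /= /deriv_val memNset. Qed.

Lemma pdB f g k x : A x -> pd k (f - g : smooth_fn A) x = pd k f x - pd k g x.
Proof.
move=> Ax.
have [V [F [oV Vx CF Ff]]] := smooth_fnP f Ax.
have [W [K [oW Wx CK Kg]]] := smooth_fnP g Ax.
rewrite (pd_smooth k oV Vx CF Ff Ax) (pd_smooth k oW Wx CK Kg Ax).
have [_ /(_ k)[/(_ x Vx) dF _]] := CF 1%N; have [_ /(_ k)[/(_ x Wx) dK _]] := CK 1%N.
rewrite -(deriveB dF dK).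
have FK y : (V `&` W) y -> A y -> (F - K) y = (f - g : smooth_fn A) y.
  by move=> [Vy Wy] Ay; rewrite -[RHS]/(f y - g y) -Ff // -Kg.
exact: (pd_extension oO (openI oV oW) (conj Vx Wx) Ax FK (derivableB dF dK)).
Qed.

Lemma pdM f g k x : A x ->
  pd k (f * g : smooth_fn A) x = pd k f x * g x + f x * pd k g x.
Proof.
move=> Ax.
have [V [F [oV Vx CF Ff]]] := smooth_fnP f Ax.
have [W [K [oW Wx CK Kg]]] := smooth_fnP g Ax.
rewrite (pd_smooth k oV Vx CF Ff Ax) (pd_smooth k oW Wx CK Kg Ax).
have [_ /(_ k)[/(_ x Vx) dF _]] := CF 1%N; have [_ /(_ k)[/(_ x Wx) dK _]] := CK 1%N.
rewrite -(Ff x) // -(Kg x) // addrC [X in _ + X]mulrC -(deriveM dF dK).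
have FK y : (V `&` W) y -> A y -> (F * K) y = (f * g : smooth_fn A) y.
  by move=> [Vy Wy] Ay; rewrite -[RHS]/(f y * g y) -Ff // -Kg.
exact: (pd_extension oO (openI oV oW) (conj Vx Wx) Ax FK (derivableM dF dK)).
Qed.

Lemma deriv_is_zmod_morphism k : zmod_morphism (deriv k).
Proof.
move=> f g; apply: smooth_fn_eq => x; rewrite -[RHS]/(deriv k f x - deriv k g x).
have [Ax|nAx] := pselect (A x); first by rewrite !derivE // pdB.
by rewrite !deriv_out // subr0.
Qed.

HB.instance Definition _ k := GRing.isZmodMorphism.Build (smooth_fn A)
  (smooth_fn A) (deriv k) (deriv_is_zmod_morphism k).

Lemma derivM k f g : deriv k (f * g) = deriv k f * g + f * deriv k g.
Proof.
apply: smooth_fn_eq => x.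
rewrite -[RHS]/(deriv k f x * g x + f x * deriv k g x).
have [Ax|nAx] := pselect (A x); first by rewrite !derivE // pdM.
by rewrite !deriv_out // mul0r mulr0 addr0.
Qed.

(** Partial derivatives of a local extension of f extend those of f, which reduces the claim on A,
    boundary included, to [schwarz] for the extension. *)
Lemma derivC k l f : deriv k (deriv l f) = deriv l (deriv k f).
Proof.
apply: smooth_fn_eq => x.
have [Ax|nAx] := pselect (A x); last by rewrite !deriv_out.
have [V [F [oV Vx CF Ff]]] := smooth_fnP f Ax.
have C1 i r : Cr r V ('D_(basis_vec R i) F).
  by have [_ /(_ i)[_ +]] := CF r.+1; apply.
have C0 i j : {for x, continuous ('D_(basis_vec R i) ('D_(basis_vec R j) F))}.
  by have [_ /(_ i)[_ C]] := C1 j 1%N; exact: (@Cr_continuous _ _ 0%N V _ x C Vx).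
have dl i y : V y -> A y -> 'D_(basis_vec R i) F y = deriv i f y.
  by move=> Vy Ay; rewrite derivE // (pd_smooth i oV Vy CF Ff Ay).
rewrite derivE // (pd_smooth k oV Vx (C1 l) (dl l) Ax).
rewrite derivE // (pd_smooth l oV Vx (C1 k) (dl k) Ax).
apply: (schwarz oV Vx) => // y Vy.
- by have [_ /(_ l)[+ _]] := CF 1%N; apply.
- by have [_ /(_ k)[+ _]] := CF 1%N; apply.
- by have [_ /(_ k)[+ _]] := C1 l 1%N; apply.
- by have [_ /(_ l)[+ _]] := C1 k 1%N; apply.
Qed.

End SmoothDerivations.

(** * Geometry of a chart as evaluation of the algebraic one *)

Section ChartGeometry.
Variables (R : realType) (n : nat) (O : set 'rV[R]_n).
Hypothesis oO : open O.
Let A := O `&` @half_space R n.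
Local Notation S := (smooth_fn A).
Local Notation D := (fun k => deriv oO k : {additive S -> S}).
Implicit Types (x y : 'rV[R]_n) (i j k l : 'I_n).

Lemma extend_smooth f (d : R) : smooth_on A f ->
  smooth_on A (fun x => if x \in A then f x else d).
Proof. by apply: eq_smooth_on => x Ax; rewrite mem_set. Qed.

(** The default [d] off A is left to the caller: Kronecker deltas for the metric, 0 for the
    potential. *)
Definition extend f (d : R) (sf : smooth_on A f) : S := mk_smooth (extend_smooth d sf).

Lemma extendE f d (sf : smooth_on A f) x : A x -> ev x (extend d sf) = f x.
Proof. by move=> Ax; rewrite /ev /= mem_set. Qed.

Lemma extend_out f d (sf : smooth_on A f) x : ~ A x -> ev x (extend d sf) = d.
Proof. by move=> Ax; rewrite /ev /= memNset. Qed.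

Lemma evM x (f g : S) : ev x (f * g) = ev x f * ev x g. Proof. by []. Qed.

Lemma evD x (f g : S) : ev x (f + g) = ev x f + ev x g. Proof. by []. Qed.

Lemma evB x (f g : S) : ev x (f - g) = ev x f - ev x g. Proof. by []. Qed.

Lemma ev_nat x (i : nat) : ev x (i%:R : S) = i%:R.
Proof. by elim: i => [|i IH] //; rewrite !mulrS evD IH. Qed.

Lemma ev_sum x (I : Type) (r : seq I) (P : pred I) (F : I -> S) :
  ev x (\sum_(i <- r | P i) F i) = \sum_(i <- r | P i) ev x (F i).
Proof. exact: rmorph_sum. Qed.

Definition cst_fn (r : R) : S := mk_smooth (@smooth_on_cst R n A r).

Lemma deriv_cst k r : deriv oO k (cst_fn r) = 0.
Proof.
apply: smooth_fn_eq => x; rewrite -[RHS]/(0 : R).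
have [Ax|nAx] := pselect (A x); last by rewrite deriv_out.
rewrite derivE //; have C c : Cr c setT (cst r : 'rV[R]_n -> R) by exact: Cr_cst.
by rewrite (@pd_smooth _ _ _ oO (cst_fn r) x setT (cst r)) ?derive_cst //; exact: openT.
Qed.

Lemma smooth_fn_inv (f : S) : (forall x, f x != 0) -> exists g : S, f * g = 1.
Proof.
move=> f0; exists (mk_smooth (smooth_onV (fun x _ => f0 x) (smooth_fnP f))).
by apply: smooth_fn_eq => x; rewrite -[RHS]/(1 : R) -[LHS]/(f x * (f x)^-1) mulfV.
Qed.

Lemma ev_deriv x k (f : S) (h : 'rV[R]_n -> R) : A x ->
  (forall y, A y -> h y = ev y f) -> pd k h x = ev x (deriv oO k f).
Proof. by move=> Ax hf; rewrite /ev derivE // (eq_pd oO k hf Ax). Qed.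

Variable G : 'rV[R]_n -> 'M[R]_n.
Hypothesis Gsmooth : forall i j, smooth_on A (fun x => G x i j).
Hypothesis Gsym : forall x, A x -> (G x)^T = G x.
Hypothesis Gunit : forall x, A x -> G x \in unitmx.

(* The identity matrix off A keeps metric_fn invertible over the ring S. *)
Definition metric_fn : 'M[S]_n := \matrix_(i, j) extend (i == j)%:R (Gsmooth i j).

Lemma ev_metric x : A x -> map_mx (ev x) metric_fn = G x.
Proof. by move=> Ax; apply/matrixP => i j; rewrite !mxE extendE. Qed.

Lemma ev_metric_out x : ~ A x -> map_mx (ev x) metric_fn = 1%:M.
Proof. by move=> Ax; apply/matrixP => i j; rewrite !mxE extend_out. Qed.

Lemma metric_fn_sym : metric_fn^T = metric_fn.
Proof.
apply/matrixP => i j; apply: smooth_fn_eq => x.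
rewrite -[LHS]/(ev x _) -[RHS]/(ev x _) !mxE.
have [Ax|nAx] := pselect (A x); last by rewrite !extend_out // eq_sym.
by rewrite !extendE // -[in LHS](Gsym Ax) mxE.
Qed.

(** The determinant vanishes nowhere, neither on A nor off A, where it is 1; so it is a unit of the
    ring and Cramer's rule applies. *)
Lemma metric_fn_inverse : exists H : 'M[S]_n, metric_fn *m H = 1%:M.
Proof.
have [x|d dE] := @smooth_fn_inv (\det metric_fn).
  rewrite -[X in X != _]/(ev x (\det metric_fn)) -det_map_mx.
  have [Ax|nAx] := pselect (A x).
    by rewrite ev_metric // -unitfE -unitmxE Gunit.
  by rewrite ev_metric_out // det1 oner_neq0.
exists (d *: \adj metric_fn).
by rewrite -scalemxAr mul_mx_adj scale_scalar_mx mulrC dE.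
Qed.

Variable H : 'M[S]_n.
Hypothesis GH : metric_fn *m H = 1%:M.

Lemma ev_inverse x : A x -> map_mx (ev x) H = invmx (G x).
Proof.
move=> Ax; rewrite -(ev_metric Ax); have e := congr1 (map_mx (ev x)) GH.
rewrite map_mxM map_mx1 in e.
have [u _] := mulmx1_unit e.
by rewrite -[LHS](mulKmx u) e mulmx1.
Qed.

Let half : S := cst_fn 2^-1.

Lemma half_fn : 2 * half = 1.
Proof.
apply: smooth_fn_eq => x.
rewrite -[RHS]/(1 : R) -[LHS]/(ev x (2 * half)) evM rmorph_nat.
by rewrite /ev /= mulfV // pnatr_eq0.
Qed.

Definition conn := connection_mx D half metric_fn H.

Lemma christoffel_ev x k i j : A x -> christoffel G x k i j = ev x (conn i j k).
Proof.
move=> Ax; rewrite /christoffel /conn /connection_mx mxE ev_sum mulr_sumr.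
apply: eq_bigr => l _; rewrite !mxE !evM evB evD.
have e a b c : pd a (fun y => G y b c) x = ev x (deriv oO a (metric_fn b c)).
  by apply: ev_deriv => // y Ay; rewrite -(ev_metric Ay) mxE.
rewrite !e -(ev_inverse Ax) mxE.
rewrite (_ : H k l = H l k); last by rewrite -[in LHS](Hsym metric_fn_sym GH) mxE.
by rewrite -mulrA; congr (_ * _); rewrite mulrC !mxE.
Qed.

(** Covariant derivative along the field with constant components X. *)
Definition nab (X : 'rV[R]_n) (Y : 'rV[S]_n) : 'rV[S]_n :=
  \sum_k cst_fn (X 0 k) *: (map_mx (deriv oO k) Y + Y *m conn k).

Lemma nabla_ev x (X : 'rV[R]_n) (Y : 'rV[R]_n -> 'rV[R]_n) (Ys : 'rV[S]_n) :
  A x -> (forall y, A y -> Y y = map_mx (ev y) Ys) ->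
  nabla G (fun=> X) Y x = map_mx (ev x) (nab X Ys).
Proof.
move=> Ax YE; apply/rowP => c; rewrite !mxE /dvec summxE ev_sum.
rewrite (_ : \sum_i \sum_j _ = \sum_k X 0 k * \sum_j christoffel G x c k j * Y x 0 j); last first.
  apply: eq_bigr => k _; rewrite mulr_sumr; apply: eq_bigr => j _.
  by rewrite [X 0 k * _]mulrCA mulrA.
rewrite -big_split; apply: eq_bigr => k _ /=.
rewrite -mulrDr !mxE evM evD ev_sum; congr (_ * (_ + _)).
  by rewrite (@ev_deriv x k (Ys 0 c)) // => y Ay; rewrite YE // mxE.
apply: eq_bigr => j _. by rewrite evM christoffel_ev // YE // [map_mx _ _ 0 j]mxE mulrC.

Qed.

Definition crow (X : 'rV[R]_n) : 'rV[S]_n := map_mx cst_fn X.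

Lemma ev_crow x X : map_mx (ev x) (crow X) = X.
Proof. by apply/rowP => i; rewrite !mxE. Qed.

Lemma deriv_crow k X : map_mx (deriv oO k) (crow X) = 0.
Proof. by apply/rowP => i; rewrite !mxE deriv_cst. Qed.

Lemma deriv_cstZ k r (M : 'rV[S]_n) :
  map_mx (deriv oO k) (cst_fn r *: M) = cst_fn r *: map_mx (deriv oO k) M.
Proof. by apply/rowP => i; rewrite !mxE derivM deriv_cst mul0r add0r. Qed.

Lemma map_deriv_sum k p q (I : Type) (r : seq I) (P : pred I) (F : I -> 'M[S]_(p, q)) :
  map_mx (deriv oO k) (\sum_(i <- r | P i) F i) =
  \sum_(i <- r | P i) map_mx (deriv oO k) (F i).
Proof. exact: raddf_sum. Qed.

Lemma map_ev_sum x p q (I : Type) (r : seq I) (P : pred I) (F : I -> 'M[S]_(p, q)) :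
  map_mx (ev x) (\sum_(i <- r | P i) F i) =
  \sum_(i <- r | P i) map_mx (ev x) (F i).
Proof. exact: raddf_sum. Qed.

Lemma deriv_crow_mul k Z p (M : 'M[S]_(n, p)) :
  map_mx (deriv oO k) (crow Z *m M) = crow Z *m map_mx (deriv oO k) M.
Proof.
apply: etrans (derivation_mulmx (derivM oO k) (crow Z) M) _.
rewrite -[RHS]add0r; congr (_ + _).
by rewrite (_ : map_mx _ _ = 0) ?mul0mx //; exact: deriv_crow.
Qed.

Definition curvature := curvature_mx D conn.
Local Notation Fx x k a := (map_mx (ev x) (curvature k a)).

(** For constant Z the iterated derivative is Z (D_k A_a + A_a A_k), as rows multiply from the left;
    antisymmetrising gives the curvature matrix. *)
Lemma nab_nab (X Y Z : 'rV[R]_n) :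
  nab X (nab Y (crow Z)) - nab Y (nab X (crow Z)) =
  \sum_k \sum_a (cst_fn (X 0 k) * cst_fn (Y 0 a)) *: (crow Z *m curvature k a).
Proof.
have e (U V : 'rV[R]_n) : nab U (nab V (crow Z)) =
    \sum_k \sum_a (cst_fn (U 0 k) * cst_fn (V 0 a)) *:
      (crow Z *m (map_mx (deriv oO k) (conn a) + conn a *m conn k)).
  rewrite /nab; apply: eq_bigr => k _.
  rewrite map_deriv_sum mulmx_suml -big_split scaler_sumr; apply: eq_bigr => a _ /=.
  rewrite -scalerA; congr (_ *: _).
  rewrite deriv_crow add0r -scalemxAl mulmxDr (mulmxA (crow Z) (conn a)).
  rewrite [RHS]scalerDr; congr (_ + _).
  by rewrite deriv_cstZ deriv_crow_mul.
rewrite !e [X in _ - X]exchange_big -sumrB; apply: eq_bigr => k _ /=.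
rewrite -sumrB; apply: eq_bigr => a _ /=.
rewrite [cst_fn (Y 0 a) * _]mulrC -scalerBr -mulmxBr /curvature /curvature_mx.
have cancel (P Q U V : 'M[S]_n) : P + Q - (U + V) = P - U + Q - V.
  by apply/matrixP => i j; rewrite !mxE; ring.
by rewrite cancel.
Qed.

Lemma curv_ev x X Y Z W : A x -> curv G x X Y Z W =
  \sum_k \sum_a X 0 k * Y 0 a * (Z *m Fx x k a *m G x *m W^T) 0 0.
Proof.
move=> Ax; rewrite /curv /curv_field /ev2.
have c0 (V : 'rV[R]_n) (y : 'rV[R]_n) : A y -> (fun=> V) y = map_mx (ev y) (crow V).
  by move=> _; rewrite ev_crow.
have n1 U V y : A y -> nabla G (fun=> U) (fun=> V) y = map_mx (ev y) (nab U (crow V)).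
  by move=> Ay; apply: nabla_ev => // z; apply: c0.
have n2 U V V' : nabla G (fun=> U) (nabla G (fun=> V) (fun=> V')) x =
    map_mx (ev x) (nab U (nab V (crow V'))).
  by apply: nabla_ev => // y Ay; apply: n1.
have pd0 (c : R) k : pd k (fun=> c) x = 0.
  by rewrite (@ev_deriv x k (cst_fn c)) // deriv_cst.
(* Fields with constant components commute, so the bracket term drops out. *)
have -> : nabla G (lie (fun=> X) (fun=> Y)) (fun=> Z) x = 0.
  apply/rowP => c; rewrite !mxE /dvec big1 ?add0r => [|i _]; last by rewrite pd0 mulr0.
  rewrite big1 // => i _; rewrite big1 // => j _.
  by rewrite !mxE /dvec !big1 ?subrr ?mulr0 ?mul0r // => l _; rewrite pd0 mulr0.
rewrite !n2 subr0 -map_mxB nab_nab.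
rewrite map_ev_sum !mulmx_suml summxE; apply: eq_bigr => k _.
rewrite map_ev_sum !mulmx_suml summxE; apply: eq_bigr => a _ /=.
rewrite map_mxZ -!scalemxAl [LHS]mxE map_mxM ev_crow.
by [].
Qed.

Lemma Ric_ev x : A x -> Ric G x = map_mx (ev x) (ricci_mx D metric_fn H conn).
Proof.
move=> Ax; apply/matrixP => a b.
rewrite [LHS]mxE [RHS]mxE [X in ev x X]mxE ev_sum /gtrace.
apply: eq_bigr => c _; rewrite ev_sum; apply: eq_bigr => d _.
rewrite evM -(ev_inverse Ax) [map_mx _ H c d]mxE; congr (_ * _).
rewrite mxE curv_ev // (bigD1 a) //= [X in _ + X]big1 ?addr0; last first.
  move=> k ka; apply: big1 => l _; rewrite [basis_vec R a 0 k]mxE.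
  by rewrite (negbTE ka) andbF !mul0r.
rewrite (bigD1 c) //= [X in _ + X]big1 ?addr0; last first.
  move=> k ka; rewrite [basis_vec R c 0 k]mxE.
  by rewrite (negbTE ka) andbF mulr0 mul0r.
rewrite [basis_vec R a 0 a]mxE [basis_vec R c 0 c]mxE !eqxx !mul1r.
rewrite -(ev_metric Ax) -(mulmxA (basis_vec R d)) -map_mxM /=.
rewrite /basis_vec -rowE trmx_delta -colE !mxE.
by [].
Qed.

Lemma gtrace_ev x (T : 'M[S]_n) : A x ->
  gtrace (G x) (map_mx (ev x) T) = ev x (\tr (H *m T)).
Proof.
move=> Ax; rewrite /gtrace /mxtrace ev_sum exchange_big; apply: eq_bigr => b _ /=.
rewrite [X in ev x X]mxE ev_sum; apply: eq_bigr => a _.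
rewrite evM -(ev_inverse Ax) !mxE.
by rewrite (_ : H a b = H b a) // -[in LHS](Hsym metric_fn_sym GH) mxE.
Qed.

Lemma scal_ev x : A x -> scal G x = ev x (scalar_curvature D metric_fn H conn).
Proof. by move=> Ax; rewrite /scal Ric_ev // gtrace_ev. Qed.

Lemma dvec_basis (f : 'rV[R]_n -> R) x k : dvec f x (basis_vec R k) = pd k f x.
Proof.
rewrite /dvec (bigD1 k) //= big1 ?addr0 => [|i ik]; first by rewrite mxE !eqxx mul1r.
by rewrite mxE (negbTE ik) andbF mul0r.
Qed.

Lemma Hess_ev x (u : 'rV[R]_n -> R) (U : S) : A x -> (forall y, A y -> u y = ev y U) ->
  Hess G u x = map_mx (ev x) (hessian_mx D conn U).
Proof.
move=> Ax uU; apply/matrixP => a b.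
rewrite [LHS]mxE [RHS]mxE [X in ev x X]mxE evB ev_sum dvec_basis; congr (_ - _).
  apply: ev_deriv => // y Ay; rewrite dvec_basis; exact: ev_deriv.
apply: eq_bigr => l _; rewrite evM (ev_deriv l Ax uU); congr (_ * _).
rewrite -christoffel_ev // mxE [X in X + _](_ : _ = 0) ?add0r; last first.
  by rewrite dvec_basis (@ev_deriv x a (cst_fn (basis_vec R b 0 l))) // deriv_cst.
rewrite (bigD1 a) //= [X in _ + X]big1 ?addr0; last first.
  move=> i ia; apply: big1 => j _; rewrite [basis_vec R a 0 i]mxE.
  by rewrite (negbTE ia) andbF mulr0 mul0r.
rewrite (bigD1 b) //= [X in _ + X]big1 ?addr0; last first.
  move=> j jb; rewrite [basis_vec R b 0 j]mxE.
  by rewrite (negbTE jb) andbF mulr0.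
by rewrite !mxE !eqxx !mulr1.
Qed.

(** On constant fields the derivative acts on T alone, and the two connection terms are exactly the
    products subtracted in [dtensor]. *)
Lemma cov_deriv_ev x (T : 'rV[R]_n -> 'M[R]_n) (Ts : 'M[S]_n) (X Y Z : 'rV[R]_n) :
  A x -> (forall y, A y -> T y = map_mx (ev y) Ts) ->
  cov_deriv G T x X Y Z =
  \sum_k X 0 k * (Y *m map_mx (ev x) (dtensor D conn Ts k) *m Z^T) 0 0.
Proof.
move=> Ax TE; rewrite /cov_deriv /ev2.
have n1 (U V : 'rV[R]_n) : nabla G (fun=> U) (fun=> V) x = map_mx (ev x) (nab U (crow V)).
  by apply: nabla_ev => // y Ay; rewrite ev_crow.
have n2 (U V : 'rV[R]_n) : map_mx (ev x) (nab U (crow V)) =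
    \sum_k U 0 k *: (V *m map_mx (ev x) (conn k)).
  rewrite map_ev_sum; apply: eq_bigr => k _.
  by rewrite deriv_crow add0r map_mxZ map_mxM ev_crow.
have n3 (U V : 'rV[R]_n) : (map_mx (ev x) (nab U (crow V)))^T =
    \sum_k U 0 k *: (V *m map_mx (ev x) (conn k))^T.
  rewrite n2; apply: etrans (raddf_sum _ _ _ _) _; apply: eq_bigr => k _.
  exact: linearZ.
rewrite !n1 n3 n2 !mulmx_suml mulmx_sumr !summxE /dvec -!sumrB.
apply: eq_bigr => k _.
have sc (c : R) (M : 'M[R]_1) : (c *: M) 0 0 = c * M 0 0 by rewrite mxE.
rewrite -!scalemxAl -scalemxAr !sc -!mulrBr; congr (_ * _).
have -> : pd k (fun y => (Y *m T y *m Z^T) 0 0) x =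
    (Y *m map_mx (ev x) (map_mx (deriv oO k) Ts) *m Z^T) 0 0.
  rewrite (@ev_deriv x k ((crow Y *m (Ts *m (crow Z)^T)) 0 0)) //; last first.
    move=> y Ay; rewrite TE // -{1}(ev_crow y Y) -{1}(ev_crow y Z) map_trmx -!map_mxM.
    by rewrite mulmxA [LHS]mxE.
  have -> : deriv oO k ((crow Y *m (Ts *m (crow Z)^T)) 0 0) =
      (crow Y *m (map_mx (deriv oO k) Ts *m (crow Z)^T)) 0 0.
    have -> : deriv oO k ((crow Y *m (Ts *m (crow Z)^T)) 0 0) =
      (map_mx (deriv oO k) (crow Y *m (Ts *m (crow Z)^T))) 0 0 by rewrite [RHS]mxE.
    rewrite deriv_crow_mul; congr ((_ *m _) 0 0).
    apply: etrans (derivation_mulmx (derivM oO k) Ts (crow Z)^T) _.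
    rewrite -[RHS]addr0; congr (_ + _).
    rewrite (_ : map_mx _ (crow Z)^T = 0) ?mulmx0 //.
    by rewrite -map_trmx; apply/trmx_inj; rewrite trmxK trmx0; exact: deriv_crow.
  rewrite -[LHS](_ : map_mx (ev x) (crow Y *m (map_mx (deriv oO k) Ts *m (crow Z)^T)) 0 0 = _).
    by rewrite !map_mxM -map_trmx !ev_crow mulmxA.
  by rewrite [LHS]mxE.
rewrite TE // /dtensor; move: (conn k) => B.
rewrite !map_mxB !map_mxM trmx_mul -map_trmx.
rewrite !(mulmxBr, mulmxBl) !mulmxA.
repeat match goal with |- context [?P *m ?Q] => move: (P *m Q) => ? end.
by rewrite !mxE.
Qed.

Lemma grad_ev x (u : 'rV[R]_n -> R) (U : S) : A x -> (forall y, A y -> u y = ev y U) ->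
  grad G u x = map_mx (ev x) (gradient_row D H U).
Proof.
move=> Ax uU; rewrite /grad /sharp /gradient_row map_mxM ev_inverse //; congr (_ *m _).
by apply/rowP => l; rewrite !mxE (ev_deriv l Ax uU).
Qed.

Variables (lambda m : R).

Definition rhoS := rho_fun D metric_fn H conn (cst_fn lambda) (cst_fn (m - 1)^-1).

Lemma rho_ev x : A x -> rho G lambda m x = ev x rhoS.
Proof.
move=> Ax; rewrite /rho /rhoS /rho_fun evM evB evM evB scal_ev //.
by rewrite ev_nat.
Qed.

Definition PS := P_mx D metric_fn H conn (cst_fn lambda) (cst_fn (m - 1)^-1).

Lemma Pten_ev x : A x -> Pten G lambda m x = map_mx (ev x) PS.
Proof.
move=> Ax; rewrite /Pten /PS /P_mx Ric_ev // rho_ev // map_mxB map_mxZ ev_metric //.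
Qed.

End ChartGeometry.

(** * Contraction of component identities with three vectors *)

Section TrilinearSums.
Variables (R : comNzRingType) (n : nat) (X Y Z : 'rV[R]_n).
Implicit Types (f h : 'I_n -> 'I_n -> 'I_n -> R).

Definition sum3 f := \sum_k \sum_a \sum_b X 0 k * Y 0 a * Z 0 b * f k a b.

Lemma eq_sum3 f h : (forall k a b, f k a b = h k a b) -> sum3 f = sum3 h.
Proof.
move=> fh; apply: eq_bigr => k _; apply: eq_bigr => a _; apply: eq_bigr => b _.
by rewrite fh.
Qed.

Lemma sum3D f h : sum3 (fun k a b => f k a b + h k a b) = sum3 f + sum3 h.
Proof.
rewrite /sum3 -big_split; apply: eq_bigr => k _; rewrite -big_split.
apply: eq_bigr => a _; rewrite -big_split; apply: eq_bigr => b _ /=.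
by rewrite mulrDr.
Qed.

Lemma sum3Z c f : sum3 (fun k a b => c * f k a b) = c * sum3 f.
Proof.
rewrite /sum3 mulr_sumr; apply: eq_bigr => k _; rewrite mulr_sumr.
apply: eq_bigr => a _; rewrite mulr_sumr; apply: eq_bigr => b _.
by rewrite mulrCA.
Qed.

Lemma sum3B f h : sum3 (fun k a b => f k a b - h k a b) = sum3 f - sum3 h.
Proof.
rewrite -[in RHS]mulN1r -sum3Z -sum3D; apply: eq_sum3 => k a b.
by rewrite mulN1r.
Qed.

Lemma bilinearE (V W : 'rV[R]_n) (M : 'M[R]_n) :
  (V *m M *m W^T) 0 0 = \sum_a \sum_b V 0 a * W 0 b * M a b.
Proof.
rewrite mxE exchange_big; apply: eq_bigr => b _ /=.
rewrite [_ 0 b]mxE [W^T b 0]mxE mulr_suml; apply: eq_bigr => a _.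
by rewrite mulrAC.
Qed.

Lemma dotE (V W : 'rV[R]_n) : (V *m W^T) 0 0 = \sum_a V 0 a * W 0 a.
Proof. by rewrite mxE; apply: eq_bigr => a _; rewrite [_^T _ _]mxE. Qed.

Lemma sum3_XYZ (alpha : 'rV[R]_n) (M : 'M[R]_n) :
  sum3 (fun k a b => alpha 0 k * M a b) =
  (X *m alpha^T) 0 0 * (Y *m M *m Z^T) 0 0.
Proof.
rewrite dotE bilinearE mulr_suml; apply: eq_bigr => k _; rewrite mulr_sumr.
apply: eq_bigr => a _; rewrite mulr_sumr; apply: eq_bigr => b _; ring.
Qed.

Lemma sum3_YXZ (alpha : 'rV[R]_n) (M : 'M[R]_n) :
  sum3 (fun k a b => alpha 0 a * M k b) =
  (Y *m alpha^T) 0 0 * (X *m M *m Z^T) 0 0.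
Proof.
rewrite dotE bilinearE mulr_suml /sum3 exchange_big; apply: eq_bigr => a _.
rewrite mulr_sumr; apply: eq_bigr => k _; rewrite mulr_sumr.
apply: eq_bigr => b _; ring.
Qed.

Lemma sum3_family (M : 'I_n -> 'M[R]_n) :
  sum3 (fun k a b => M k a b) = \sum_k X 0 k * (Y *m M k *m Z^T) 0 0.
Proof.
apply: eq_bigr => k _; rewrite bilinearE mulr_sumr; apply: eq_bigr => a _.
by rewrite mulr_sumr; apply: eq_bigr => b _; rewrite !mulrA.
Qed.

Lemma sum3_family_swap (M : 'I_n -> 'M[R]_n) :
  sum3 (fun k a b => M a k b) = \sum_a Y 0 a * (X *m M a *m Z^T) 0 0.
Proof.
rewrite /sum3 exchange_big; apply: eq_bigr => a _; rewrite bilinearE mulr_sumr.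
apply: eq_bigr => k _; rewrite mulr_sumr; apply: eq_bigr => b _.
by rewrite (mulrC (X 0 k)) !mulrA.
Qed.

Lemma sum3_pair (M : 'I_n -> 'I_n -> 'M[R]_n) (alpha : 'rV[R]_n) :
  sum3 (fun k a b => \sum_l M k a b l * alpha 0 l) =
  \sum_k \sum_a X 0 k * Y 0 a * (Z *m M k a *m alpha^T) 0 0.
Proof.
apply: eq_bigr => k _; apply: eq_bigr => a _.
rewrite bilinearE mulr_sumr; apply: eq_bigr => b _.
rewrite !mulr_sumr; apply: eq_bigr => l _; ring.
Qed.

End TrilinearSums.

(** * The identity in one chart *)

Section EinsteinChart.
Variables (R : realType) (n : nat) (O : set 'rV[R]_n).
Hypothesis oO : open O.
Let A := O `&` @half_space R n.
Local Notation S := (smooth_fn A).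
Local Notation D := (fun k => deriv oO k : {additive S -> S}).
Variable G : 'rV[R]_n -> 'M[R]_n.
Hypothesis Gsmooth : forall i j, smooth_on A (fun x => G x i j).
Hypothesis Gsym : forall x, A x -> (G x)^T = G x.
Hypothesis Gunit : forall x, A x -> G x \in unitmx.
Variables (u : 'rV[R]_n -> R) (lambda m : R).
Hypothesis m_gt1 : 1 < m.
Hypothesis usmooth : smooth_on A u.
Hypothesis u_einstein : forall x, A x ->
  Hess G u x = (u x / m) *: (Ric G x - lambda *: G x).

Section Inverse.
Variable H : 'M[S]_n.
Hypothesis GH : metric_fn Gsmooth *m H = 1%:M.
Let U := extend 0 usmooth.
Local Notation Gs := (metric_fn Gsmooth).
Local Notation conn := (conn oO Gsmooth H).
Local Notation ricciS := (ricci_mx D Gs H conn).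
Local Notation lam := (cst_fn O lambda).
Local Notation mS := (cst_fn O m).

Let uU y : A y -> u y = ev y U. Proof. by move=> Ay; rewrite extendE. Qed.

Let Gs_sym : Gs^T = Gs. Proof. exact: metric_fn_sym. Qed.
Let half2 : 2 * cst_fn O 2^-1 = 1. Proof. exact: half_fn. Qed.

Let compatible k : map_mx (D k) Gs = conn k *m Gs + Gs *m (conn k)^T.
Proof. exact: (metric_compatible D half2 Gs_sym GH). Qed.

Let torsion k j : row j (conn k) = row k (conn j).
Proof. exact: torsion_free. Qed.

(** On A this is the Einstein equation multiplied by m. Off A both sides vanish: [U] is extended by
    0 and all derivatives are 0 there. *)
Lemma einstein_fn :
  mS *: hessian_mx D conn U = U *: (ricciS - lam *: Gs).
Proof.
have m0 : m != 0 by rewrite gt_eqF // (lt_trans ltr01).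
apply/matrixP => a b; apply: smooth_fn_eq => x.
rewrite -[LHS]/(ev x _) -[RHS]/(ev x _).
rewrite [X in ev x X = _]mxE [X in _ = ev x X]mxE !evM.
have [Ax|nAx] := pselect (A x).
  have := u_einstein Ax; rewrite (Hess_ev oO Gsym GH Ax uU) (uU Ax).
  rewrite (Ric_ev oO Gsym GH Ax) => /matrixP/(_ a b).
  rewrite [X in X = _]mxE => ->; rewrite -(ev_metric Gsmooth Ax).
  have -> : lambda = ev x lam by [].
  rewrite -map_mxZ -map_mxB mxE [map_mx _ _ a b]mxE -[ev x mS]/m.
  by rewrite mulrA mulrCA mulfV // mulr1.
rewrite [ev x U]extend_out // mul0r [X in _ * ev x X]mxE evB ev_sum big1; last first.
  by move=> l _; rewrite evM /ev deriv_out // mulr0.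
by rewrite /ev deriv_out // subrr mulr0.
Qed.

Lemma codazzi_ev x k a b : A x ->
  let dP k := map_mx (ev x) (dtensor D conn (PS oO Gsmooth H lambda m) k) in
  let du := \row_l pd l u x in
  let T := Ric G x - lambda *: G x in
  let p := grad G u x *m Pten G lambda m x in
  u x * (dP k a b - dP a k b) =
  - (m * \sum_l map_mx (ev x) (curvature oO Gsmooth H k a) b l * du 0 l)
  - du 0 k * T a b + du 0 a * T k b
  - 2 * (p 0 k * G x a b) + 2 * (p 0 a * G x k b).
Proof.
move=> Ax dP du T p.
have D0 r i : D i (cst_fn O r) = 0 by exact: deriv_cst.
have rE : cst_fn O (m - 1)^-1 * (mS - 1) = 1.
  apply: smooth_fn_eq => y; rewrite -[LHS]/((m - 1)^-1 * (m - 1)) mulVf //.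
  by rewrite subr_eq0 gt_eqF.
have := codazzi_P (@derivM _ _ _ oO) (@derivC _ _ _ oO) half2 Gs_sym GH compatible
  torsion (D0 m) (D0 lambda) einstein_fn (D0 (m - 1)^-1) rE k a b.
move/(congr1 (ev x)).
have evN f : ev x (- f : S) = - ev x f by [].
have duE l : ev x (deriv oO l U) = du 0 l by rewrite mxE (ev_deriv oO l Ax uU).
have TE i : ev x ((ricciS - lam *: Gs) i b) = T i b.
  by rewrite /T (Ric_ev oO Gsym GH Ax) -(ev_metric Gsmooth Ax) !mxE evB evM.
have pE i : ev x ((gradient_row D H U *m PS oO Gsmooth H lambda m) 0 i) = p 0 i.
  rewrite /p (grad_ev oO GH Ax uU) (Pten_ev oO Gsym GH lambda m Ax) -map_mxM.
  by rewrite [RHS]mxE.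
have gE i j : ev x (Gs i j) = G x i j by rewrite -(ev_metric Gsmooth Ax) [RHS]mxE.
have dPE i j : ev x (dtensor D conn (PS oO Gsmooth H lambda m) i j b) = dP i j b.
  by rewrite [RHS]mxE.
rewrite (evM x U) evB !dPE -(uU Ax) => ->.
have ev2 : ev x (2 : S) = 2 by exact: ev_nat.
rewrite evD evB evD evB evN !evM !ev2 ev_sum !TE !pE !gE !duE.
congr (_ + _); last by rewrite mulrA.
congr (_ - _); last by rewrite mulrA.
congr (- (_ * _) - _ + _); apply: eq_bigr => l _.
by rewrite evM duE [map_mx _ _ b l]mxE.
Qed.

Lemma einstein_chart_inverse x X Y Z : A x ->
  u x / m * (cov_deriv G (Pten G lambda m) x X Y Z
             - cov_deriv G (Pten G lambda m) x Y X Z) =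
  - Qten G lambda m x X Y Z (grad G u x)
  - m^-1 * odot (G x) (G x) X Y Z (Pvec G lambda m x (grad G u x)).
Proof.
move=> Ax; set v := grad G u x.
have PE y : A y -> Pten G lambda m y = map_mx (ev y) (PS oO Gsmooth H lambda m).
  by move=> Ay; apply: (Pten_ev oO Gsym GH).
pose dP k := map_mx (ev x) (dtensor D conn (PS oO Gsmooth H lambda m) k).
pose du := \row_l pd l u x.
pose T := Ric G x - lambda *: G x.
pose p := v *m Pten G lambda m x.
pose F k a := map_mx (ev x) (curvature oO Gsmooth H k a).
rewrite (cov_deriv_ev oO Gsym GH X Y Z Ax PE) (cov_deriv_ev oO Gsym GH Y X Z Ax PE).
rewrite -(sum3_family X Y Z dP) -(sum3_family_swap X Y Z dP) -sum3B.
have key : u x * sum3 X Y Z (fun k a b => dP k a b - dP a k b) =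
    - (m * sum3 X Y Z (fun k a b => \sum_l F k a b l * du 0 l))
    - (X *m du^T) 0 0 * (Y *m T *m Z^T) 0 0
    + (Y *m du^T) 0 0 * (X *m T *m Z^T) 0 0
    - 2 * ((X *m p^T) 0 0 * (Y *m G x *m Z^T) 0 0)
    + 2 * ((Y *m p^T) 0 0 * (X *m G x *m Z^T) 0 0).
  rewrite -!(sum3_XYZ X Y Z) -!(sum3_YXZ X Y Z) -!sum3Z.
  rewrite (_ : - sum3 X Y Z _ = sum3 X Y Z
    (fun k a b => -1 * (m * \sum_l F k a b l * du 0 l))); last first.
    by rewrite !sum3Z mulN1r.
  rewrite -sum3B -sum3D -sum3B -sum3D; apply: eq_sum3 => k a b.
  by rewrite mulN1r; exact: codazzi_ev.
have vG : v *m G x = du by rewrite /v /grad /sharp mulmxKV // Gunit.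
have RicS : (Ric G x)^T = Ric G x.
  rewrite (Ric_ev oO Gsym GH Ax) map_trmx.
  by rewrite (ricci_sym (@derivM _ _ _ oO) (@derivC _ _ _ oO) half2 Gs_sym GH compatible torsion).
have PS' : (Pten G lambda m x)^T = Pten G lambda m x.
  by rewrite /Pten raddfB /= linearZ /= RicS Gsym.
have curvE : curv G x X Y Z v = sum3 X Y Z (fun k a b => \sum_l F k a b l * du 0 l).
  rewrite sum3_pair (curv_ev oO Gsym GH) //; apply: eq_bigr => k _; apply: eq_bigr => a _.
  by rewrite -vG (trmx_mul v) Gsym // !mulmxA.
have g1 V : ev2 (G x) V v = (V *m du^T) 0 0.
  by rewrite /ev2 -vG (trmx_mul v) Gsym // mulmxA.
have p1 V : ev2 (G x) V (Pvec G lambda m x v) = (V *m p^T) 0 0.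
  rewrite /ev2 /Pvec /sharp -/p; congr (_ 0 0); rewrite -mulmxA; congr (_ *m _).
  by rewrite -{1}(Gsym Ax) -trmx_mul mulmxKV // Gunit.
(* Ric = P + rho g trades Ric(grad u) for P(grad u), the only form in which it occurs in [key]. *)
have r1 V : ev2 (Ric G x) V v = (V *m p^T) 0 0 + rho G lambda m x * (V *m du^T) 0 0.
  rewrite -g1 /ev2 /p (trmx_mul v) PS' mulmxA /Pten mulmxBr mulmxBl.
  rewrite -scalemxAr -scalemxAl; move: (_ *m Ric G x *m _) (_ *m G x *m _) => M N.
  by rewrite !mxE subrK.
have t1 V : (V *m T *m Z^T) 0 0 = ev2 (Ric G x) V Z - lambda * ev2 (G x) V Z.
  rewrite /T /ev2 mulmxBr mulmxBl -scalemxAr -scalemxAl.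
  move: (_ *m Ric G x *m _) (_ *m G x *m _) => M N.
  by rewrite !mxE.
have m0 : m != 0 by rewrite gt_eqF // (lt_trans ltr01).
rewrite mulrAC key /Qten curvE /odot !p1 !g1 !r1 !t1.
have e2 V : (V *m G x *m Z^T) 0 0 = ev2 (G x) V Z by [].
rewrite !e2.
(* After [key] the value u x has disappeared; an identity between scalars remains, with only m and 2
   in denominators. *)
move: (sum3 _ _ _ _) ((X *m du^T) 0 0) ((Y *m du^T) 0 0) ((X *m p^T) 0 0)
  ((Y *m p^T) 0 0) (ev2 (Ric G x) Y Z) (ev2 (Ric G x) X Z) (ev2 (G x) Y Z)
  (ev2 (G x) X Z) (rho G lambda m x) => s dX dY pX pY rY rX gY gX rh.
by field.
Qed.

End Inverse.

Lemma einstein_chart x X Y Z : A x ->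
  u x / m * (cov_deriv G (Pten G lambda m) x X Y Z
             - cov_deriv G (Pten G lambda m) x Y X Z) =
  - Qten G lambda m x X Y Z (grad G u x)
  - m^-1 * odot (G x) (G x) X Y Z (Pvec G lambda m x (grad G u x)).
Proof.
have [H GH] := metric_fn_inverse Gsmooth Gunit.
exact: (einstein_chart_inverse GH).
Qed.

End EinsteinChart.

Theorem proposition6p2 (R : realType) (n : nat) (M : smooth_manifold R n)
    (g : riemannian_metric M) (w : M -> R) (lambda m : R) (m_gt1 : 1 < m)
    (einstein_M : einstein g w lambda m)
    (p : M) (X Y Z : tangent_vector p) (c : chart M) (cp : dom c p) :
  let G := g c in
  let x := cmap c p in
  let P := Pten G lambda m in
  let gradw := grad G (w \o param c) x in
  w p / m * (cov_deriv G P x (X c) (Y c) (Z c)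
             - cov_deriv G P x (Y c) (X c) (Z c)) =
  - Qten G lambda m x (X c) (Y c) (Z c) gradw
  - m^-1 * odot (G x) (G x) (X c) (Y c) (Z c) (Pvec G lambda m x gradw).
Proof.
move=> G x P gradw.
(* The chart image is relatively open in the half-space, and V serves as the open set [O] of the
   chart computation. *)
have [V oV imgE] := cmap_image c.
have imgP y : (V `&` @half_space R n) y -> img c y by rewrite /img imgE.
(* A null vector of G would contradict positivity of the metric. *)
have Gunit y : img c y -> G y \in unitmx.
  move=> cy; rewrite unitmxE unitfE; apply/negP => /det0P[v v0 vG].
  have := coeff_pos g cy v0; rewrite /ev2 vG mul0mx mxE ltxx.
  by [].
have w_param : w p = (w \o param c) x by rewrite /= /x cmapK.
rewrite w_param; apply: (einstein_chart oV) => //.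
- by move=> i j; rewrite -imgE; exact: coeff_smooth.
- by move=> y /imgP; exact: coeff_sym.
- by move=> y /imgP; exact: Gunit.
- by rewrite -imgE; exact: (einstein_smooth einstein_M).
- move=> y /imgP[q cq <-]; rewrite /= cmapK //; exact: (einstein_hess einstein_M).
- by rewrite -imgE; exists p.
Qed.
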